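(* Let $n\ge 1$. The growth rate function $\tau:\mathcal{D}_n\to\mathbb{R}_{\ge 1}$, $(D,S)\mapsto\tau(D,S)$, on the space $\mathcal{D}_n$ of $n$-marked Dyer systems is continuous.
   Context: **Marked groups.** An $n$-marked group is a pair $(G,S)$ where $G$ is a group and $S=(s_1,\dots,s_n)$ is an ordered generating set of $G$. Two $n$-marked groups $(G,S)$, $(H,T)$ are isomorphic if $s_i\mapsto t_i$ extends to a group isomorphism $G\to H$. $\mathcal{G}_n$ is the set of isomorphism classes of $n$-marked groups. Fix the free group $\mathbb{F}_n$ with an ordered free basis $X=(x_1,\dots,x_n)$; let $\pi_{(G,S)}:\mathbb{F}_n\to G$ be the epimorphism $x_i\mapsto s_i$, and let $B(R)$ be the ball of radius $R$ about $1$ in $\mathbb{F}_n$ for the word length with respect to $X$. The metric on $\mathcal{G}_n$ is $d((G,S),(H,T))=e^{-v}$, where $v=\max\{R\ge 0: B(R)\cap\ker\pi_{(G,S)}=B(R)\cap\ker\pi_{(H,T)}\}$ ($v=\infty$ and $d=0$ if the kernels coincide). **Growth rate.** $b_{(G,S)}(m)$ is the number of $x\in G$ of word length $|x|_S\le m$ (with respect to $S\cup S^{-1}$), and $\tau(G,S)=\lim_{m\to\infty}\sqrt[m]{b_{(G,S)}(m)}$ (the limit exists). **Dyer systems.** Let $\widehat{\mathbb{N}}=\mathbb{N}\cup\{\infty\}$ and $[a,b]_k=aba\cdots$ ($k$ alternating factors). A pair $(D,S)$ with $D$ a group generated by $S=\{s_1,\dots,s_n\}$ is a Dyer system if $D$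 admits a presentation $$D=\langle s_1,\dots,s_n\mid s_i^{f_i}=1,\ [s_i,s_j]_{m_{ij}}=[s_j,s_i]_{m_{ij}}\ (i\neq j)\rangle,$$ where $f_i\in\widehat{\mathbb{N}}_{\ge 2}$, $m_{ij}=m_{ji}\in\widehat{\mathbb{N}}_{\ge 2}$, and $m_{ij}\in\{2,\infty\}$ whenever $f_i\ge 3$ or $f_j\ge 3$; relations with $f_i=\infty$ or $m_{ij}=\infty$ are omitted. If $S$ is totally ordered, $(D,S)$ is an $n$-marked Dyer system. $\mathcal{D}_n\subset\mathcal{G}_n$ is the subspace of (isomorphism classes of) $n$-marked Dyer systems, with the induced topology. *)

(* Defs.v *)
From HB Require Import structures.
From mathcomp Require Import all_boot all_order all_algebra.
From mathcomp Require Import generic_quotient finmap.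
From mathcomp Require Import all_classical all_reals all_analysis.

Set Implicit Arguments.
Unset Strict Implicit.
Unset Printing Implicit Defensive.

Import Order.TTheory GRing.Theory Num.Theory.
Import numFieldNormedType.Exports.

Local Open Scope classical_set_scope.
Local Open Scope group_scope.

(* The letter (i, false) stands for s_i and (i, true) for s_i^-1. *)
Definition letter (n : nat) : Type := 'I_n * bool.
HB.instance Definition _ n := Finite.on (letter n).

Definition word_eval n (G : groupType) (s : 'I_n -> G) (w : seq (letter n)) : G :=
  foldr (fun a x => (if a.2 then (s a.1)^-1 else s a.1) * x) 1 w.

Definition spans n (G : groupType) (s : 'I_n -> G) : Prop :=
  forall x, exists w, word_eval s w = x.

Section WordLength.
Context {n : nat} {G : groupType} {s : 'I_n -> G} (sP : spans s).

Lemma ex_word_length (x : G) : exists k,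
  `[< exists2 w, size w = k & word_eval s w = x >].
Proof.
by have [w wx] := sP x; exists (size w); apply/asboolP; exists w.
Qed.

Definition word_length (x : G) : nat := ex_minn (ex_word_length x).

Definition word_ball (m : nat) : set G := [set x | (word_length x <= m)%N].

Lemma word_ballP m x : word_ball m x <->
  exists2 w, (size w <= m)%N & word_eval s w = x.
Proof.
rewrite /word_ball/= /word_length; case: ex_minnP => k /asboolP[w wk wx] kmin.
split=> [km|[w' w'm w'x]]; first by exists w; rewrite ?wk.
by apply: leq_trans w'm; apply: kmin; apply/asboolP; exists w'.
Qed.

Lemma finite_word_ball m : finite_set (word_ball m).
Proof.
apply: (@sub_finite_set _ _
  ((fun w : m.-bseq (letter n) => word_eval s w) @` setT)).
  by move=> x /word_ballP[w wm wx]; exists (Bseq wm).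
exact: finite_image.
Qed.

Definition growth (m : nat) : nat := #|` fset_set (word_ball m)|.

End WordLength.

(* The free group on 'I_n, as the group of reduced words. *)
Section FreeGroup.
Context {n : nat}.
Implicit Types (a b : letter n) (u v w : seq (letter n)).

Definition letter_inv a : letter n := (a.1, ~~ a.2).

Definition reduced w : bool := sorted (fun a b => b != letter_inv a) w.

Lemma letter_invK : involutive letter_inv.
Proof. by case=> i b; rewrite /letter_inv/= negbK. Qed.

Definition push a w : seq (letter n) :=
  if w is b :: w' then if b == letter_inv a then w' else a :: w else [:: a].

Lemma push_reduced a w : reduced w -> reduced (push a w).
Proof.
case: w => //= b w; case: ifPn => [_ /path_sorted//|ab pw].
by rewrite /reduced/= ab.
Qed.

Lemma push_cons a w : reduced (a :: w) -> push a w = a :: w.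
Proof. by case: w => //= b w /andP[/negPf ->]. Qed.

Lemma pushVK a w : reduced w -> push a (push (letter_inv a) w) = w.
Proof.
case: w => [_|b w] /=; first by rewrite eqxx.
rewrite letter_invK; case: (eqVneq b a) => [-> rw|_ _] /=; last by rewrite eqxx.
exact: push_cons.
Qed.

Definition free_group : Type := {w : seq (letter n) | reduced w}.
HB.instance Definition _ := Choice.on free_group.
HB.instance Definition _ := SubChoice.on free_group.
Implicit Types x y z : free_group.

Definition fmul u v : seq (letter n) := foldr push v u.

Lemma fmul_reduced u v : reduced v -> reduced (fmul u v).
Proof. by move=> rv; elim: u => //= a u IH; exact: push_reduced. Qed.

Lemma fmul_push a u v : reduced v -> fmul (push a u) v = push a (fmul u v).
Proof.
move=> rv; case: u => //= b u; case: eqVneq => //= ->.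
by rewrite pushVK// fmul_reduced.
Qed.

Lemma fmulA u v w : reduced v -> reduced w ->
  fmul u (fmul v w) = fmul (fmul u v) w.
Proof. by move=> rv rw; elim: u => //= a u ->; rewrite fmul_push. Qed.

Lemma fmul_nil u : reduced u -> fmul u [::] = u.
Proof.
elim: u => //= a u IH rau; rewrite IH ?push_cons//.
by move: rau; exact: path_sorted.
Qed.

Definition finv u : seq (letter n) := rev (map letter_inv u).

Lemma finvK u : finv (finv u) = u.
Proof. by rewrite /finv map_rev revK -map_comp (eq_map letter_invK) map_id. Qed.

Lemma finv_reduced u : reduced u -> reduced (finv u).
Proof.
rewrite /reduced /finv rev_sorted sorted_map.
apply: sub_sorted => a b /=; apply: contraNneq => /(congr1 letter_inv).
by rewrite !letter_invK => ->; rewrite letter_invK.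
Qed.

Lemma fmulV u : reduced u -> fmul (finv u) u = [::].
Proof.
elim: u => //= a u IH rau; rewrite /finv/= rev_cons /fmul foldr_rcons/=.
by rewrite letter_invK eqxx; apply: IH; move: rau; exact: path_sorted.
Qed.

Definition free_one : free_group := exist _ [::] isT.
Definition free_mul x y : free_group :=
  exist _ (fmul (val x) (val y)) (fmul_reduced _ (valP y)).
Definition free_inv x : free_group :=
  exist _ (finv (val x)) (finv_reduced (valP x)).

Lemma free_mulA : associative free_mul.
Proof. by move=> x y z; apply: val_inj; apply: fmulA; exact: valP. Qed.
Lemma free_mul1 : left_id free_one free_mul.
Proof. by move=> x; apply: val_inj. Qed.
Lemma free_mulr1 : right_id free_one free_mul.
Proof. by move=> x; apply: val_inj; exact: fmul_nil (valP x). Qed.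
Lemma free_mulV : left_inverse free_one free_inv free_mul.
Proof. by move=> x; apply: val_inj; exact: fmulV (valP x). Qed.
Lemma free_mulrV : right_inverse free_one free_inv free_mul.
Proof.
move=> x; apply: val_inj => /=.
by rewrite -{1}[val x]finvK fmulV// finv_reduced//; exact: valP.
Qed.

HB.instance Definition _ := monoid.isGroup.Build free_group
  free_mulA free_mul1 free_mulr1 free_mulV free_mulrV.

Definition free_gen (i : 'I_n) : free_group := exist _ [:: (i, false)] isT.

Lemma val_free_eval w : val (word_eval free_gen w) = fmul w [::].
Proof.
by elim: w => //= -[i b] w IH; case: b; rewrite /= -IH.
Qed.

Lemma free_spans x : exists w, word_eval free_gen w = x.
Proof.
exists (val x); apply: val_inj; rewrite val_free_eval.
exact: fmul_nil (valP x).
Qed.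

Lemma size_fmul u : (size (fmul u [::]) <= size u)%N.
Proof.
elim: u => //= a u; rewrite -ltnS; apply: leq_trans.
by case: (fmul u [::]) => //= b w; case: ifP => //= _; rewrite leqW.
Qed.

End FreeGroup.
Arguments free_group : clear implicits.

Lemma free_word_length n (x : free_group n) :
  word_length free_spans x = size (val x).
Proof.
rewrite /word_length; case: ex_minnP => k /asboolP[w wk wx] kmin.
apply/eqP; rewrite eqn_leq; apply/andP; split.
  apply: kmin; apply/asboolP; exists (val x) => //.
  by apply: val_inj; rewrite val_free_eval fmul_nil//; exact: valP.
by rewrite -wx -wk val_free_eval size_fmul.
Qed.

(* A groupType whose carrier lives in a universe strictly below that of the
   library's structures; this is what allows the isomorphism classes below to
   form a choiceType, hence a metricType.  No isomorphism class is lost, see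
   [marked_group_of] below. *)
Record small_group := SmallGroup {
  sg_sort :> Type;
  sg_class : monoid.Group sg_sort }.
HB.instance Definition _ (G : small_group) : monoid.Group (sg_sort G) :=
  sg_class G.

Record marked_group (n : nat) := MarkedGroup {
  mg_group :> small_group;
  mg_gen : 'I_n -> mg_group;
  mg_spans : spans mg_gen }.

Definition marked_iso n (g h : marked_group n) : Prop :=
  exists f : g -> h, [/\ bijective f, {morph f : x y / x * y}
    & forall i, f (mg_gen g i) = mg_gen h i].

Section MarkedGroupOf.
Context {n : nat} {G : groupType} {s : 'I_n -> G} (sP : spans s).

Let code (x : G) : nat := choice.pickle (projT1 (cid (sP x))).

Let code_inj : injective code.
Proof.
move=> x y /(pcan_inj choice.pickleK) xy.
by rewrite -(projT2 (cid (sP x))) xy (projT2 (cid (sP y))).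
Qed.

Let codes : pred nat := fun k => `[< exists x, code x = k >].
Definition coded_group := {k : nat | codes k}.
HB.instance Definition _ := Choice.on coded_group.

Let codesP (x : G) : codes (code x).
Proof. by apply/asboolP; exists x. Qed.

Let enc (x : G) : coded_group := exist _ (code x) (codesP x).
Let dec (k : coded_group) : G := projT1 (cid (asboolW (valP k))).

Let decK : cancel dec enc.
Proof. by move=> k; apply: val_inj; rewrite /= /dec; case: cid. Qed.

Let encK : cancel enc dec.
Proof. by move=> x; apply: code_inj; have /(congr1 val) := decK (enc x). Qed.

Let one : coded_group := enc 1.
Let inv (k : coded_group) := enc (dec k)^-1.
Let mul (k l : coded_group) := enc (dec k * dec l).

Let mulA : associative mul.
Proof. by move=> i j k; rewrite /mul !encK mulgA. Qed.
Let mul1 : left_id one mul.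
Proof. by move=> k; rewrite /mul encK mul1g decK. Qed.
Let mulr1 : right_id one mul.
Proof. by move=> k; rewrite /mul encK mulg1 decK. Qed.
Let mulV : left_inverse one inv mul.
Proof. by move=> k; rewrite /mul encK mulVg. Qed.
Let mulrV : right_inverse one inv mul.
Proof. by move=> k; rewrite /mul encK mulgV. Qed.

HB.instance Definition _ := monoid.isGroup.Build coded_group
  mulA mul1 mulr1 mulV mulrV.

Let decM : {morph dec : k l / k * l}.
Proof. by move=> k l; exact: encK. Qed.

Let enc_spans : spans (fun i => enc (s i)).
Proof.
move=> k; have [w wk] := sP (dec k); exists w; apply: (can_inj decK).
rewrite -{}wk; elim: w => [|[i b] w IH] /=; first exact: encK.
rewrite decM IH; case: b => /=; last by rewrite encK.
by congr (_ * _); rewrite [LHS]encK encK.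
Qed.

Lemma marked_group_of : exists (g : marked_group n) (f : g -> G),
  [/\ bijective f, {morph f : x y / x * y} & forall i, f (mg_gen g i) = s i].
Proof.
exists (@MarkedGroup n (@SmallGroup coded_group (monoid.Group.on coded_group))
  _ enc_spans).
by exists dec; split => // [|i]; [exists enc | exact: encK].
Qed.

End MarkedGroupOf.

Definition growth_rate (R : realType) n (g : marked_group n) : R :=
  lim ((growth (@mg_spans n g) m)%:R `^ (m%:R^-1) @[m --> \oo])%R.

Section Projection.
Context {n : nat} (g : marked_group n).

Definition marked_proj (x : free_group n) : g :=
  word_eval (@mg_gen n g) (val x).

Lemma word_eval_push a w : word_eval (@mg_gen n g) (push a w) =
  (if a.2 then (mg_gen g a.1)^-1 else mg_gen g a.1) * word_eval (@mg_gen n g) w.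
Proof.
case: w => //= b w; case: eqVneq => //= ->; rewrite mulgA /=.
by case: (a.2); rewrite /= (mulVg, mulgV) mul1g.
Qed.

Lemma word_eval_fmul u v : word_eval (@mg_gen n g) (fmul u v) =
  word_eval (@mg_gen n g) u * word_eval (@mg_gen n g) v.
Proof.
by elim: u => [|a u IH] /=; rewrite ?mul1g// word_eval_push IH mulgA.
Qed.

Lemma marked_projM : {morph marked_proj : x y / x * y}.
Proof. by move=> x y; exact: word_eval_fmul. Qed.

HB.instance Definition _ :=
  monoid.isMultiplicative.Build (free_group n) g marked_proj marked_projM.

Lemma marked_proj_gen i : marked_proj (free_gen i) = mg_gen g i.
Proof. exact: mulg1. Qed.

Lemma marked_proj_surj (y : g) : exists x, marked_proj x = y.
Proof.
have [w <-] := mg_spans y; exists (word_eval free_gen w).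
by rewrite /marked_proj val_free_eval word_eval_fmul mulg1.
Qed.

Definition marked_ker : set (free_group n) := [set x | marked_proj x = 1].

End Projection.

Lemma marked_proj1 n (g : marked_group n) : marked_proj g 1 = 1.
Proof. by []. Qed.

Lemma marked_projV n (g : marked_group n) x :
  marked_proj g x^-1 = (marked_proj g x)^-1.
Proof.
by apply: (@mulgI _ (marked_proj g x)); rewrite -marked_projM !mulgV.
Qed.

Lemma marked_iso_proj n (g h : marked_group n) (f : g -> h) :
  {morph f : x y / x * y} -> (forall i, f (mg_gen g i) = mg_gen h i) ->
  forall w, f (word_eval (@mg_gen n g) w) = word_eval (@mg_gen n h) w.
Proof.
move=> fM fg.
have f1 : f 1 = 1 by apply: (@mulgI _ (f 1)); rewrite -fM !mulg1.
have fV x : f x^-1 = (f x)^-1.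
  by apply: (@mulgI _ (f x)); rewrite -fM !mulgV.
by elim=> //= -[i b] w IH; rewrite fM IH; case: b => /=; rewrite ?fV fg.
Qed.

Lemma marked_isoP n (g h : marked_group n) :
  marked_iso g h <-> marked_ker g = marked_ker h.
Proof.
split=> [[f [/bij_inj finj fM fg]]|kgh].
  have fp := marked_iso_proj fM fg; have f1 : f 1 = 1 := fp [::].
  apply/seteqP; split => x /= kx; rewrite /marked_ker/= /marked_proj.
    by rewrite -fp -f1; congr f.
  by apply: finj; rewrite fp f1.
have eqgh x y : marked_proj g x = marked_proj g y <->
    marked_proj h x = marked_proj h y.
  have E (k : marked_group n) : marked_proj k x = marked_proj k y <->
      marked_ker k (x * y^-1).
    rewrite /marked_ker/= marked_projM marked_projV.
    by split=> [->|e]; [rewrite mulgV | rewrite -[LHS](mulgVK (marked_proj k y)) e mul1g].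
  by rewrite !E kgh.
have [r rK] := choice (marked_proj_surj (g := g)).
have [t tK] := choice (marked_proj_surj (g := h)).
exists (fun x => marked_proj h (r x)); split.
- exists (fun y => marked_proj g (t y)) => x.
    by rewrite -[RHS]rK; apply/eqgh; rewrite tK.
  by rewrite -[RHS]tK; apply/eqgh; rewrite rK.
- by move=> x y /=; rewrite -marked_projM; apply/eqgh; rewrite marked_projM !rK.
- by move=> i; rewrite -[RHS]marked_proj_gen; apply/eqgh; rewrite rK marked_proj_gen.
Qed.

Section Presentation.
Context {n : nat}.
Implicit Types (N A : set (free_group n)).

Definition normal_subgroup N : Prop :=
  [/\ N 1, forall x y, N x -> N y -> N (x * y^-1)
    & forall x y : free_group n, N x -> N (x ^ y)].

Definition normal_closure A : set (free_group n) :=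
  \bigcap_(N in [set N | normal_subgroup N /\ A `<=` N]) N.

(* ker (F_n -> G) is the normal closure of A, i.e. G = < s_1, ..., s_n | A >. *)
Definition presented_by (g : marked_group n) A : Prop :=
  marked_ker g = normal_closure A.

End Presentation.

(* Elements of N u {oo}; None stands for oo. *)
Definition natbar : Type := option nat.
Definition natbar_ge (x : natbar) (k : nat) : bool :=
  if x is Some a then (k <= a)%N else true.

Fixpoint alt_prod (G : groupType) (a b : G) (k : nat) : G :=
  if k is k'.+1 then a * alt_prod b a k' else 1.

Section Dyer.
Context {n : nat} (f : 'I_n -> natbar) (m : 'I_n -> 'I_n -> natbar).

Definition dyer_data : Prop :=
  (forall i, natbar_ge (f i) 2) /\
  (forall i j : 'I_n, i != j ->
    [/\ m i j = m j i, natbar_ge (m i j) 2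
      & natbar_ge (f i) 3 || natbar_ge (f j) 3 ->
        m i j = Some 2 \/ m i j = None]).

Definition dyer_relators : set (free_group n) :=
  [set x | exists i k, f i = Some k /\ x = free_gen i ^+ k] `|`
  [set x | exists (i j : 'I_n) k, [/\ i != j, m i j = Some k
    & x = alt_prod (free_gen i) (free_gen j) k *
          (alt_prod (free_gen j) (free_gen i) k)^-1]].

End Dyer.

Definition is_dyer n (g : marked_group n) : Prop :=
  exists f m, dyer_data f m /\ presented_by g (dyer_relators f m).

HB.instance Definition _ n := gen_eqMixin (marked_group n).
HB.instance Definition _ n := gen_choiceMixin (marked_group n).

Definition marked_isob n : rel (marked_group n) := fun g h => `[< marked_iso g h >].

Lemma marked_isobP n (g h : marked_group n) :
  reflect (marked_ker g = marked_ker h) (marked_isob g h).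
Proof. by apply: (iffP (asboolP _)) => /marked_isoP. Qed.

Lemma marked_isob_refl n : reflexive (@marked_isob n).
Proof. by move=> g; apply/marked_isobP. Qed.
Lemma marked_isob_sym n : symmetric (@marked_isob n).
Proof. by move=> g h; apply/marked_isobP/marked_isobP. Qed.
Lemma marked_isob_trans n : transitive (@marked_isob n).
Proof.
by move=> h g k /marked_isobP gh /marked_isobP hk; apply/marked_isobP; rewrite gh.
Qed.

Canonical marked_isob_equiv n := EquivRel (@marked_isob n)
  (@marked_isob_refl n) (@marked_isob_sym n) (@marked_isob_trans n).
Canonical marked_isob_encModRel n := defaultEncModRel (@marked_isob n).

(* The set of isomorphism classes.  The real field R is a parameter of the type
   because the metric below is R-valued. *)
Definition marked_space (R : realType) (n : nat) : Type :=
  {eq_quot (@marked_isob n)}%qT.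
HB.instance Definition _ R n := Choice.on (marked_space R n).

Definition class_of (R : realType) n (g : marked_group n) : marked_space R n :=
  (\pi_{eq_quot (@marked_isob n)} g)%qT.
Definition class_repr (R : realType) n (x : marked_space R n) : marked_group n :=
  repr (x : {eq_quot (@marked_isob n)}%qT).

Lemma class_reprK (R : realType) n : cancel (@class_repr R n) (@class_of R n).
Proof. exact: reprK. Qed.

Lemma class_ofP (R : realType) n (g h : marked_group n) :
  class_of R g = class_of R h <-> marked_iso g h.
Proof.
split; first by move/eqmodP => /asboolP.
by move=> gh; apply/eqmodP; exact/asboolP.
Qed.

Lemma class_repr_iso (R : realType) n (g : marked_group n) :
  marked_iso (class_repr (class_of R g)) g.
Proof. by apply/(class_ofP R); rewrite class_reprK. Qed.

Section Distance.
Local Open Scope ring_scope.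
Context {R : realType} {n : nat}.
Implicit Types g h k : marked_group n.

Definition agree g h : set nat :=
  [set r | word_ball (@free_spans n) r `&` marked_ker g =
           word_ball (@free_spans n) r `&` marked_ker h].

(* [agree g h] contains 0 and is downward closed, so that the supremum is a
   maximum when it is finite; it is +oo iff the two kernels coincide. *)
Definition agree_radius g h : \bar R :=
  ereal_sup [set r%:R%:E | r in agree g h].

Definition marked_dist g h : R := fine (expeR (- agree_radius g h)).

Lemma agree_le g h r r' : (r' <= r)%N -> agree g h r -> agree g h r'.
Proof.
move=> rr' /seteqP[gh hg]; apply/seteqP; split => x [xr kx]; split => //.
  by have [] := gh x; first by split => //; exact: leq_trans xr rr'.
by have [] := hg x; first by split => //; exact: leq_trans xr rr'.
Qed.

Lemma agree0 g h : agree g h 0.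
Proof.
have E x : word_ball (@free_spans n) 0 x -> x = 1%g.
  rewrite /word_ball/= free_word_length leqn0 size_eq0 => /eqP e.
  exact: val_inj.
by apply/seteqP; split => x [xr kx]; split => //; rewrite (E _ xr).
Qed.

Lemma agree_radiusP g h r : agree g h r <-> (r%:R%:E <= agree_radius g h)%E.
Proof.
split=> [ar|]; first by apply: ereal_sup_ubound; exists r.
apply: contraPP => Nar; apply/negP; rewrite -ltNge.
case: r Nar => [/(_ (agree0 _ _))//|r Nar].
apply: (@le_lt_trans _ _ r%:R%:E); last by rewrite lte_fin ltr_nat.
apply: ge_ereal_sup => _ [s sa <-]; rewrite lee_fin ler_nat leqNgt.
by apply/negP => rs; apply: Nar; exact: agree_le sa.
Qed.

Lemma agree_radius_ge0 g h : (0 <= agree_radius g h)%E.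
Proof. by have /agree_radiusP := agree0 g h. Qed.

Lemma agree_radiusy g h : agree_radius g h = +oo%E <-> marked_ker g = marked_ker h.
Proof.
split=> [y|e]; last first.
  apply/eqyP => r r0; apply: (@le_trans _ _ (Num.truncn r).+1%:R%:E).
    by rewrite lee_fin ltW// truncnS_gt.
  by apply/agree_radiusP; rewrite /agree/= e.
have A r : agree g h r by apply/agree_radiusP; rewrite y leey.
apply/seteqP; split => x kx; have /seteqP[B C] := A (word_length free_spans x).
  by have [] := B x; first by split => //; exact: leqnn.
by have [] := C x; first by split => //; exact: leqnn.
Qed.

Lemma marked_dist_eq0 g h : marked_dist g h = 0 <-> marked_ker g = marked_ker h.
Proof.
rewrite -agree_radiusy /marked_dist; have := agree_radius_ge0 g h.
case: (agree_radius g h) => [r _|//|//] /=; split => // /eqP.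
by rewrite gt_eqF// expR_gt0.
Qed.

Lemma marked_dist_ge0 g h : 0 <= marked_dist g h.
Proof. by apply: fine_ge0; exact: expeR_ge0. Qed.

Lemma marked_dist_sym g h : marked_dist g h = marked_dist h g.
Proof.
suff E : agree g h = agree h g by rewrite /marked_dist /agree_radius E.
by apply/seteqP; split => r; exact: esym.
Qed.

Lemma marked_dist_le g h g' h' :
  (agree_radius g h <= agree_radius g' h')%E -> marked_dist g' h' <= marked_dist g h.
Proof.
move=> gh; apply: fine_le; rewrite ?lee_expeR ?leeN2// fin_numE.
- have := agree_radius_ge0 g' h'.
  by case: (agree_radius g' h').
- have := agree_radius_ge0 g h.
  by case: (agree_radius g h).
Qed.

Lemma marked_dist_ultra h g k :
  marked_dist g k <= Num.max (marked_dist g h) (marked_dist h k).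
Proof.
have agree_trans r : agree g h r -> agree h k r -> agree g k r.
  by rewrite /agree/= => -> ->.
rewrite le_max; have [le|/ltW le] := leP (agree_radius g h) (agree_radius h k).
  apply/orP; left; apply: marked_dist_le; apply: ge_ereal_sup => _ [r ar <-].
  apply/agree_radiusP; apply: agree_trans => //.
  by apply/agree_radiusP; rewrite (le_trans _ le)//; exact/agree_radiusP.
apply/orP; right; apply: marked_dist_le; apply: ge_ereal_sup => _ [r ar <-].
apply/agree_radiusP; apply: agree_trans => //.
by apply/agree_radiusP; rewrite (le_trans _ le)//; exact/agree_radiusP.
Qed.

Definition class_dist (x y : marked_space R n) : R :=
  marked_dist (class_repr x) (class_repr y).

Lemma class_distE g h : class_dist (class_of R g) (class_of R h) = marked_dist g h.
Proof.
rewrite /class_dist /marked_dist /agree_radius /agree.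
have /marked_isoP -> := class_repr_iso R g.
by have /marked_isoP -> := class_repr_iso R h.
Qed.

Lemma class_distxx x : class_dist x x = 0.
Proof. exact/marked_dist_eq0. Qed.

Lemma class_dist_positivity x y : class_dist x y = 0 -> x = y.
Proof.
move=> /marked_dist_eq0/marked_isoP/(class_ofP R); by rewrite !class_reprK.
Qed.

Lemma class_dist_sym x y : class_dist x y = class_dist y x.
Proof. exact: marked_dist_sym. Qed.

Lemma class_dist_triangle y x z :
  class_dist x z <= class_dist x y + class_dist y z.
Proof.
apply: le_trans (marked_dist_ultra (class_repr y) _ _) _.
by rewrite ge_max lerDl lerDr !marked_dist_ge0.
Qed.

HB.instance Definition _ := @isMetric.Build R (marked_space R n) class_dist
  class_distxx class_dist_positivity class_dist_sym class_dist_triangle.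

End Distance.

Definition dyer_space (R : realType) n : set (marked_space R n) :=
  [set class_of R g | g in @is_dyer n].
Arguments dyer_space : clear implicits.

Definition tau (R : realType) n (x : marked_space R n) : R :=
  growth_rate R (class_repr x).

Lemma growth_iso n (g h : marked_group n) m : marked_iso g h ->
  growth (@mg_spans n g) m = growth (@mg_spans n h) m.
Proof.
move=> [f [fb fM fg]]; have fp := marked_iso_proj fM fg.
have -> : growth (@mg_spans n h) m =
    #|` fset_set (f @` word_ball (@mg_spans n g) m)|.
  rewrite /growth; congr (#|` fset_set _ |); apply/seteqP; split => y.
    move=> /word_ballP[w wm <-]; exists (word_eval (@mg_gen n g) w) => //.
    by apply/word_ballP; exists w.
  by move=> [_ /word_ballP[w wm <-] <-]; apply/word_ballP; exists w.
rewrite fset_set_image; last exact: finite_word_ball.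
by rewrite card_imfset//; exact: bij_inj fb.
Qed.

Lemma tau_class_of (R : realType) n (g : marked_group n) :
  tau (class_of R g) = growth_rate R g.
Proof.
rewrite /tau /growth_rate.
suff -> : growth (@mg_spans n (class_repr (class_of R g))) =
  growth (@mg_spans n g) by [].
by apply/funext => m; exact: growth_iso (class_repr_iso R g).
Qed.

Lemma dyer_space_class_of (R : realType) n (g : marked_group n) :
  dyer_space R n (class_of R g) <-> is_dyer g.
Proof.
split=> [[h [f [m [fm hP]]] /class_ofP/marked_isoP hg]|]; last by exists g.
by exists f, m; split => //; rewrite /presented_by -hg.
Qed.

(* Main.v *)
Require Import Defs.
From mathcomp Require Import all_boot all_order all_algebra.
From mathcomp Require Import finmap.
From mathcomp Require Import all_classical all_reals all_analysis.
From mathcomp Require Import zify lra.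
Import Order.TTheory GRing.Theory Num.Theory numFieldNormedType.Exports.

(** Upper semicontinuity holds for all marked groups: by Fekete's lemma the growth
    rate is [inf_m b(m)^(1/m)], and [b(m)] only depends on a ball of the free group.

    For lower semicontinuity, let [A_T] be the growth series of the parabolic
    subgroup [D_T], [T] a set of generators.  A cocycle counting how often a word
    crosses each wall (conjugate of a generator), modulo the order of the generator,
    computes word lengths; it yields minimal coset representatives and hence
    Solomon's formula
      [\sum_(T \subset U) (-1)^|T| / A_T = P_U / A_U],
    where [P_U] counts the elements of [D_U] having every generator of [U] as a left
    descent.  Generators of order at least 3 that are descents of one element commute
    with the other descents, so that there are at most [(2k+1)^n] such elements of
    length [k], uniformly in the group.

    Suppose that groups [h_r] agree with [g] up to radius [r] while their growth
    rates stay below that of [g] by a fixed amount.  Take [T] minimal among the sets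
    for which [A_T] has the same radius of convergence [1/tau(g)] as the whole group.
    Slightly to the right of this radius the series [A_U] of [h_r], [U] a proper
    subset of [T], converge to those of [g], while that of [T] tends to infinity;
    with Solomon's formula for [h_r] this gives
      [\sum_(U \proper T) (-1)^|U| / A_U = 0]
    there, hence near 0 by analytic continuation.  Near 0, Solomon's formula for [g]
    then forces [P_T = (-1)^|T|], although [P_T] vanishes at 0. *)

Set Implicit Arguments.
Unset Strict Implicit.
Unset Printing Implicit Defensive.

Local Open Scope classical_set_scope.
Local Open Scope group_scope.

(** * Walls and the crossing cocycle *)

Section IntPower.
Context {G : groupType}.
Implicit Types (x y t : G) (a b : int) (d : nat).

Definition zpow t a : G := match a with Posz k => t ^+ k | Negz k => t ^- k.+1 end.

Lemma zpowS t a : zpow t (1 + a)%R = t * zpow t a.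
Proof.
case: a => [k|[|k]].
- by rewrite -PoszD add1n /= expgS.
- by rewrite /= expg1 mulgV.
- have -> : (1 + Negz k.+1 = Negz k)%R by lia.
  by rewrite /zpow [in RHS]expgSr invgM mulVKg.
Qed.

Lemma zpowP t a : zpow t (-1 + a)%R = t^-1 * zpow t a.
Proof. by rewrite -[in RHS](addKr (-1)%R a) opprK zpowS mulKg. Qed.

Lemma zpowD t a b : zpow t (a + b)%R = zpow t a * zpow t b.
Proof.
elim/int_rect: a => [|k IH|k IH]; first by rewrite add0r mul1g.
  by rewrite intS -addrA !zpowS IH mulgA.
rewrite (_ : (- k.+1%:Z)%R = (-1 + - k%:Z)%R); last by lia.
by rewrite -addrA !zpowP IH mulgA.
Qed.

Lemma zpowN t a : zpow t (- a)%R = (zpow t a)^-1.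
Proof. by apply: (mulgI (zpow t a)); rewrite -zpowD subrr mulgV. Qed.

Lemma zpowJ t x a : zpow (t ^ x) a = zpow t a ^ x.
Proof. by case: a => k /=; rewrite ?conjVg conjXg. Qed.

Lemma zpow_commute t x a : commute t x -> commute (zpow t a) x.
Proof.
move=> tx; apply: commute_sym; case: a => k /=; last apply: commuteV;
  by apply: commuteX; apply: commute_sym.
Qed.

Lemma zpow_dvd t d a : t ^+ d = 1 -> (d %| a)%Z -> zpow t a = 1.
Proof.
move=> td /dvdzP[q ->]; elim/int_rect: q => [|k IH|k IH]; first by rewrite mul0r.
  by rewrite intS mulrDl mul1r zpowD IH mulg1.
rewrite (_ : (- k.+1%:Z * d = - d%:Z + - k%:Z * d)%R); last by lia.
by rewrite zpowD IH mulg1 zpowN /= td invg1.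
Qed.

Lemma eq_zpow t d a b : t ^+ d = 1 -> (d %| (a - b)%R)%Z -> zpow t a = zpow t b.
Proof.
by move=> td ab; rewrite -(subrK b a) zpowD (zpow_dvd td ab) mul1g.
Qed.

End IntPower.

(** * Distance to zero modulo [d] *)

Section CyclicNorm.
Implicit Types (d : nat) (a b : int).

Lemma ex_cyclic_norm d a :
  exists k, `[< exists2 b : int, (d %| (b - a)%R)%Z & `|b|%N = k >].
Proof. by exists `|a|%N; apply/asboolP; exists a; rewrite ?subrr ?dvdz0. Qed.

(** Word length of the class of [a] in Z/d with respect to the generator 1. For [d = 0] this is the
    absolute value, which matches the convention for infinite order. *)
Definition cyclic_norm d a : nat := ex_minn (ex_cyclic_norm d a).

Lemma cyclic_norm_le d a b : (d %| (b - a)%R)%Z -> (cyclic_norm d a <= `|b|)%N.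
Proof.
move=> ba; rewrite /cyclic_norm; case: ex_minnP => k _; apply.
by apply/asboolP; exists b.
Qed.

Lemma cyclic_norm_ex d a : exists2 b : int, (d %| (b - a)%R)%Z & `|b|%N = cyclic_norm d a.
Proof. by rewrite /cyclic_norm; case: ex_minnP => k /asboolP. Qed.

Lemma eq_cyclic_norm d a b : (d %| (a - b)%R)%Z -> cyclic_norm d a = cyclic_norm d b.
Proof.
have le a' b' : (d %| (a' - b')%R)%Z -> (cyclic_norm d a' <= cyclic_norm d b')%N.
  move=> ab; have [c cb <-] := cyclic_norm_ex d b'; apply: cyclic_norm_le.
  have -> : (c - a' = (c - b') - (a' - b'))%R by lia.
  exact: rpredB.
by move=> ab; apply/eqP; rewrite eqn_leq !le // -opprB rpredN.
Qed.

Lemma cyclic_norm_eq0 d a : (cyclic_norm d a == 0%N) = (d %| a)%Z.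
Proof.
apply/idP/idP => [/eqP a0|da].
  have [b ba] := cyclic_norm_ex d a; rewrite a0 => /eqP.
  by rewrite absz_eq0 => /eqP b0; move: ba; rewrite b0 sub0r rpredN.
by rewrite -leqn0 -absz0 cyclic_norm_le // sub0r rpredN.
Qed.

End CyclicNorm.

(** * Walls crossed by words and by elements of the free group *)

Section Walls.
Context {n : nat} (g : marked_group n) (f : 'I_n -> natbar).
Implicit Types (i j : 'I_n) (w u v : seq (letter n)) (x y z t : g) (a b : letter n).

Local Notation s := (@mg_gen n g).
Local Notation ev := (word_eval s).

Definition big i : bool := natbar_ge (f i) 3.

(* A wall is a conjugate of a generator.  The tag records the generator, except that
   all generators of order 2 share the tag [None], as they can be conjugate. *)
Local Notation wall := (option 'I_n * g)%type.
Implicit Types p q : wall.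

Definition color i : option 'I_n := if big i then Some i else None.
Definition wall_of i : wall := (color i, s i).

(* The modulus 0 encodes an infinite order. *)
Definition gen_order i : nat := if f i is Some k then k else 0.
Definition wall_order (c : option 'I_n) : nat := if c is Some i then gen_order i else 2.

Definition wallJ p x : wall := (p.1, p.2 ^ x).

Lemma wallJM p x y : wallJ p (x * y) = wallJ (wallJ p x) y.
Proof. by rewrite /wallJ conjgM. Qed.
Lemma wallJ1 p : wallJ p 1 = p.
Proof. by case: p => c t; rewrite /wallJ conjg1. Qed.
Lemma wallJK x : cancel (wallJ^~ x) (wallJ^~ x^-1).
Proof. by move=> p; rewrite -wallJM mulgV wallJ1. Qed.
Lemma wallJKV x : cancel (wallJ^~ x^-1) (wallJ^~ x).
Proof. by move=> p; rewrite -wallJM mulVg wallJ1. Qed.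

Lemma wallJ_fix i x : commute (s i) x -> wallJ (wall_of i) x = wall_of i.
Proof. by move=> ix; rewrite /wallJ /= conjgE ix mulKg. Qed.

Lemma wallJ_eq_fix p i x : commute (s i) x ->
  (wallJ p x == wall_of i) = (p == wall_of i).
Proof.
by move=> ix; rewrite -[RHS](inj_eq (can_inj (wallJK x))) wallJ_fix.
Qed.

Definition sgn a : int := if a.2 then (-1)%R else 1%R.
Definition lt_eval a : g := if a.2 then (s a.1)^-1 else s a.1.

Lemma lt_evalE a : lt_eval a = zpow (s a.1) (sgn a).
Proof. by case: a => i []. Qed.

Lemma lt_commute a : commute (s a.1) (lt_eval a).
Proof. by case: a => i [] /=; rewrite /lt_eval /commute /= ?mulgV ?mulVg. Qed.

Lemma ev_cons a w : ev (a :: w) = lt_eval a * ev w.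
Proof. by []. Qed.
Lemma ev_cat u v : ev (u ++ v) = ev u * ev v.
Proof. by elim: u => [|a u IH] /=; rewrite ?mul1g // IH mulgA. Qed.
Lemma ev_seq1 a : ev [:: a] = lt_eval a.
Proof. exact: mulg1. Qed.
Lemma ev_finv w : ev (Defs.finv w) = (ev w)^-1.
Proof.
elim: w => [|a w IH]; first by rewrite invg1.
rewrite /Defs.finv /= rev_cons -cats1 ev_cat -/(Defs.finv w) IH invgM ev_seq1.
by case: a => i [] /=; rewrite /lt_eval /= ?invgK.
Qed.

(** In [w = u ++ a :: v], the letter [a] crosses [p] when [p] conjugated by the value of [u] is the
    wall of the generator of [a]. [crossings] counts these letters with sign, [count_cross] without,
    and [uncross] deletes them. *)
Fixpoint crossings w p : int :=
  if w is a :: w' then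
    ((if p == wall_of a.1 then sgn a else 0) + crossings w' (wallJ p (lt_eval a)))%R
  else 0%R.

Fixpoint count_cross w p : nat :=
  if w is a :: w' then
    ((p == wall_of a.1) + count_cross w' (wallJ p (lt_eval a)))%N
  else 0%N.

Fixpoint uncross w p : seq (letter n) :=
  if w is a :: w' then
    let w'' := uncross w' (wallJ p (lt_eval a)) in
    if p == wall_of a.1 then w'' else a :: w''
  else [::].

Lemma crossings_cat u v p :
  crossings (u ++ v) p = (crossings u p + crossings v (wallJ p (ev u)))%R.
Proof.
elim: u p => [|a u IH] p; first by rewrite add0r wallJ1.
by rewrite cat_cons ev_cons wallJM /= IH addrA.
Qed.

Lemma count_cross_cat u v p :
  count_cross (u ++ v) p = (count_cross u p + count_cross v (wallJ p (ev u)))%N.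
Proof.
elim: u p => [|a u IH] p; first by rewrite add0n wallJ1.
by rewrite cat_cons ev_cons wallJM /= IH addnA.
Qed.

Lemma size_uncross w p : (size (uncross w p) + count_cross w p)%N = size w.
Proof.
elim: w p => //= a w IH p; rewrite -(IH (wallJ p (lt_eval a))).
by case: eqP => /= _; rewrite ?add1n ?addnS ?add0n ?addSn.
Qed.

(* Letters crossing the wall of [t] are moved to the front, where they become powers of [t]. *)
Lemma uncrossP w c t : ev w = zpow t (crossings w (c, t)) * ev (uncross w (c, t)).
Proof.
elim: w t => [|a w IH] t; first by rewrite mul1g.
rewrite ev_cons (IH (t ^ lt_eval a)) /= zpowJ /wallJ /=.
set e := crossings w _; set x := uncross w _.
rewrite mulgA -conjgC -mulgA; case: eqP => [[_ ->]|_]; last by rewrite add0r.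
by rewrite zpowD -lt_evalE !mulgA (commute_sym (zpow_commute e (lt_commute a))).
Qed.

Lemma crossings_le w p : (`|crossings w p| <= count_cross w p)%N.
Proof.
elim: w p => //= a w IH p; apply: leq_trans (leq_add _ (IH _)); last exact: leqnn.
rewrite /sgn; case: eqP => _; case: (a.2); lia.
Qed.

Definition walls w : seq wall :=
  foldr (fun a ps => wall_of a.1 :: map (fun p => wallJ p (lt_eval a)^-1) ps) [::] w.

Lemma size_walls w : size (walls w) = size w.
Proof. by elim: w => //= a w IH; rewrite size_map IH. Qed.

Lemma count_walls w p : count_mem p (walls w) = count_cross w p.
Proof.
elim: w p => //= a w IH p; rewrite eq_sym -IH count_map; congr (_ + _)%N.
apply: eq_count => q /=.
by apply/eqP/eqP => [<-|->]; rewrite ?wallJKV ?wallJK.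
Qed.

(** [walls] lists one wall per letter, with multiplicities [count_cross]. Smaller multiplicities
    make one list a sublist of the other up to permutation. *)
Lemma size_le_count_cross w w' :
  (forall p, count_cross w p <= count_cross w' p)%N -> (size w <= size w')%N.
Proof.
move=> le; have /count_subseqP[s' s's /perm_size] :
    forall p, (count_mem p (walls w) <= count_mem p (walls w'))%N.
  by move=> p; rewrite !count_walls.
by rewrite size_walls => ->; rewrite -(size_walls w') size_subseq.
Qed.

(** A generator fixes its own wall, so a letter followed by its inverse contributes two crossings of
    one wall with opposite signs. Free reduction therefore preserves [crossings]. *)
Lemma crossings_push a w p : crossings (push a w) p = crossings (a :: w) p.
Proof.
case: w => //= b w; case: eqP => //= ->; rewrite /letter_inv /=.
have -> : lt_eval (a.1, ~~ a.2) = (lt_eval a)^-1.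
  by rewrite /lt_eval /=; case: (a.2); rewrite ?invgK.
rewrite wallJK wallJ_eq_fix; last exact: lt_commute.
by rewrite addrA /sgn /=; case: eqP; case: (a.2); rewrite ?addr0 ?add0r.
Qed.

Lemma crossings_fmul u v p : crossings (fmul u v) p = crossings (u ++ v) p.
Proof.
elim: u p => //= a u IH p.
by rewrite crossings_push /= IH.
Qed.

Definition fcross (x : free_group n) p : int := crossings (val x) p.

(** The cocycle identity for the action of the free group on integer functions on walls. *)
Lemma fcrossM (x y : free_group n) p :
  fcross (x * y) p = (fcross x p + fcross y (wallJ p (marked_proj g x)))%R.
Proof. by rewrite /fcross /= crossings_fmul crossings_cat. Qed.

Lemma fcrossV (x : free_group n) p :
  fcross x^-1 p = (- fcross x (wallJ p ((marked_proj g x)^-1)%g))%R.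
Proof.
apply/eqP; rewrite -addr_eq0 -marked_projV -fcrossM mulVg; exact/eqP.
Qed.

Lemma fcross_gen i p : fcross (free_gen i) p = (p == wall_of i)%:R%R.
Proof. by rewrite /fcross /= addr0; case: eqP. Qed.

Lemma fcross_genX i k p : fcross (free_gen i ^+ k) p = (k%:R * (p == wall_of i)%:R)%R.
Proof.
elim: k p => [|k IH] p; first by rewrite mul0r.
rewrite expgS fcrossM IH fcross_gen marked_proj_gen wallJ_eq_fix //.
by rewrite -addn1 natrD mulrDl mul1r addrC.
Qed.

End Walls.

(** * Invariance of the cocycle under the Dyer relations *)

Section AlternatingProducts.
Context {G : groupType} (a b : G).
Hypotheses (a2 : a * a = 1) (b2 : b * b = 1).

Let aV : a^-1 = a. Proof. exact: mulg1_eq. Qed.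
Let bV : b^-1 = b. Proof. exact: mulg1_eq. Qed.

Lemma expg_ab_shift k : a * (b * a) ^+ k = (a * b) ^+ k * a.
Proof.
elim: k => [|k IH]; first by rewrite mulg1 mul1g.
by rewrite expgSr mulgA IH expgSr !mulgA.
Qed.

Lemma expgV_ab k : ((a * b) ^+ k)^-1 = (b * a) ^+ k.
Proof. by rewrite -expVgn invgM aV bV. Qed.

End AlternatingProducts.

Lemma alt_prod_quotient (G : groupType) (a b : G) k : a * a = 1 -> b * b = 1 ->
  alt_prod a b k * (alt_prod b a k)^-1 = (a * b) ^+ k.
Proof.
elim: k a b => [|k IH] a b a2 b2; first by rewrite mulgV.
have bV : b^-1 = b by exact: mulg1_eq.
by rewrite /= invgM bV mulgA -(mulgA a) IH // expg_ab_shift // -mulgA -expgSr.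
Qed.

Section DyerWalls.
Context {n : nat} (g : marked_group n).
Context (f : 'I_n -> natbar) (m : 'I_n -> 'I_n -> natbar).
Hypotheses (fm : dyer_data f m) (gP : presented_by g (dyer_relators f m)).
Implicit Types (i j : 'I_n) (w u v : seq (letter n)) (x y z t : g) (a b : letter n).

Local Notation s := (@mg_gen n g).
Local Notation ev := (word_eval s).
Local Notation wall := (option 'I_n * g)%type.
Implicit Types p q : wall.

Lemma marked_projX (x : free_group n) k : marked_proj g (x ^+ k) = marked_proj g x ^+ k.
Proof. by elim: k => // k IH; rewrite !expgS marked_projM IH. Qed.

Lemma relator1 (x : free_group n) : dyer_relators f m x -> marked_proj g x = 1.
Proof.
move=> rx; suff : marked_ker g x by [].
by rewrite gP => N /= [_]; apply.
Qed.

Lemma small_order i : ~~ big f i -> f i = Some 2.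
Proof.
rewrite /big; have := fm.1 i; case: (f i) => //= k k2.
by rewrite -ltnNge => k3; congr Some; lia.
Qed.

Lemma wall_order_color i : wall_order f (color f i) = gen_order f i.
Proof.
by rewrite /color /gen_order; case: ifPn => // /small_order ->.
Qed.

Lemma genX_order i : s i ^+ gen_order f i = 1.
Proof.
rewrite /gen_order; case fi : (f i) => [k|//].
have /relator1 : dyer_relators f m (free_gen i ^+ k) by left; exists i, k.
by rewrite marked_projX marked_proj_gen.
Qed.

Lemma small_square i : ~~ big f i -> s i * s i = 1.
Proof. by move=> /small_order fi; have := genX_order i; rewrite /gen_order fi. Qed.

Lemma wall_order_ge2 i : (wall_order f (color f i) = 0 \/ 2 <= wall_order f (color f i))%N.
Proof.
rewrite wall_order_color /gen_order; have := fm.1 i.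
by case: (f i) => [k|] /=; [right | left].
Qed.

Lemma big_order i : big f i ->
  (wall_order f (color f i) = 0 \/ 3 <= wall_order f (color f i))%N.
Proof.
rewrite wall_order_color /gen_order /big.
by case: (f i) => [k|] /=; [right | left].
Qed.

Lemma marked_proj_alt i j k :
  marked_proj g (alt_prod (free_gen i) (free_gen j) k) = alt_prod (s i) (s j) k.
Proof.
by elim: k i j => //= k IH i j; rewrite marked_projM marked_proj_gen IH.
Qed.

(** The letter number [l], counted from 0, crosses the wall of the reflection
    [(s i * s j) ^+ l * s i]. The tag is [None] because both generators have order 2. *)
Lemma fcross_alt i j k p : ~~ big f i -> ~~ big f j ->
  fcross f (alt_prod (free_gen i) (free_gen j) k) p =
  (\sum_(l < k) (p == (None, (s i * s j) ^+ l * s i)%g)%:R)%R.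
Proof.
elim: k i j p => [|k IH] i j p si sj; first by rewrite big_ord0.
rewrite big_ord_recl /= fcrossM fcross_gen marked_proj_gen IH // mul1g.
rewrite /wall_of /color (negPf si); congr (_ + _)%R.
have iV : (s i)^-1 = s i by apply: mulg1_eq; exact: small_square.
apply: eq_bigr => l _; congr (nat_of_bool _)%:R%R.
rewrite /bump /= add1n -[LHS](inj_eq (can_inj (wallJK (s i)^-1))).
rewrite wallJK /wallJ /= conjgE !iV; congr (p == (_, _)).
by rewrite -(mulgA _ (s j)) -expgSr expg_ab_shift.
Qed.

(* The two sides of a braid relation cross the same walls, in opposite orders. *)
Lemma relator_fcross (x : free_group n) p : dyer_relators f m x ->
  (wall_order f p.1 %| fcross f x p)%Z.
Proof.
move=> rx; have x1 := relator1 rx; case: rx => [[i [k [fi xE]]]|[i [j [k [ij mk xE]]]]].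
  rewrite xE fcross_genX; case: eqP => [->|_]; last by rewrite mulr0 dvdz0.
  by rewrite mulr1 wall_order_color /gen_order fi natz.
move: x1; rewrite xE marked_projM marked_projV => /divg1_eq xy.
suff E : fcross f (alt_prod (free_gen i) (free_gen j) k) p =
         fcross f (alt_prod (free_gen j) (free_gen i) k) p.
  by rewrite fcrossM fcrossV -xy wallJK E subrr dvdz0.
have [ijm _ m2] := fm.2 _ _ ij.
have [ij3|] := boolP (big f i || big f j).
  case: (m2 ij3) => [m2'|]; last by rewrite mk.
  have k2 : k = 2 by move: mk; rewrite m2' => -[].
  move: xy; rewrite {}k2 !marked_proj_alt /= !mulg1 => cij.
  rewrite !fcrossM !fcross_gen !marked_proj_gen.
  rewrite (wallJ_eq_fix _ _ (commute_sym cij)) (wallJ_eq_fix _ _ cij).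
  exact: addrC.
rewrite negb_or => /andP[si sj].
move: xy; rewrite !marked_proj_alt => xy.
have a2 := small_square si; have b2 := small_square sj.
have abk : (s i * s j) ^+ k = 1 by rewrite -alt_prod_quotient // xy mulgV.
have bV : (s j)^-1 = s j by exact: mulg1_eq.
rewrite !fcross_alt // (reindex_inj rev_ord_inj) /=; apply: eq_bigr => l _.
congr (nat_of_bool (p == (_, _)))%:R%R.
rewrite expgnFr // abk mul1g expgV_ab // expgSr -[RHS]mulg1 -{1}a2.
by rewrite !mulgA.
Qed.

(** On the kernel the cocycle is additive, and conjugation only moves the wall without changing its
    tag. Hence the kernel elements with all crossings divisible form a normal subgroup; it contains
    the relators, so it contains their normal closure. *)
Lemma crossings_ker (x : free_group n) p : marked_ker g x ->
  (wall_order f p.1 %| fcross f x p)%Z.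
Proof.
move=> kx.
pose K := [set y : free_group n |
  marked_proj g y = 1 /\ forall q : wall, (wall_order f q.1 %| fcross f y q)%Z].
suff [_] : K x by [].
move: kx; rewrite gP; apply; split; last first.
  by move=> y ry; split; [exact: relator1 | move=> q; exact: relator_fcross].
split.
- by split => // q; rewrite dvdz0.
- move=> y z [y1 yN] [z1 zN]; split; first by rewrite marked_projM marked_projV y1 z1 mulgV.
  move=> q; rewrite fcrossM fcrossV; apply: rpredD => //; rewrite rpredN.
  exact: zN.
- move=> y z [y1 yN]; split.
    by rewrite conjgE !marked_projM marked_projV y1 mul1g mulVg.
  move=> q; rewrite conjgE !fcrossM fcrossV y1 wallJ1 marked_projV addrCA.
  by rewrite addNr addr0; exact: yN.
Qed.

Lemma crossings_ev1 w p : ev w = 1 -> (wall_order f p.1 %| crossings f w p)%Z.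
Proof.
move=> w1; have := @crossings_ker (word_eval free_gen w) p.
rewrite /fcross val_free_eval crossings_fmul cats0; apply.
by rewrite /marked_ker /= /marked_proj val_free_eval word_eval_fmul mulg1.
Qed.

Lemma eq_crossings w w' p : ev w = ev w' ->
  (wall_order f p.1 %| (crossings f w p - crossings f w' p)%R)%Z.
Proof.
move=> ww'.
have /crossings_ev1 A : ev (w ++ Defs.finv w') = 1 by rewrite ev_cat ev_finv ww' mulgV.
have /crossings_ev1 B : ev (w' ++ Defs.finv w') = 1 by rewrite ev_cat ev_finv mulgV.
have := rpredB (A p) (B p); rewrite !crossings_cat ww'.
by congr (_ %| _)%Z; lia.
Qed.

End DyerWalls.

(** * Word length, parabolic subgroups and descents *)

Lemma dvdz_addr (d : nat) (a b : int) : (d %| a)%Z -> (d %| b)%Z -> (d %| (a + b)%R)%Z.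
Proof. exact: rpredD. Qed.
Lemma dvdz_subr (d : nat) (a b : int) : (d %| a)%Z -> (d %| b)%Z -> (d %| (a - b)%R)%Z.
Proof. exact: rpredB. Qed.
Lemma dvdz_congr (d : nat) (a b : int) : (d %| (a - b)%R)%Z -> (d %| a)%Z = (d %| b)%Z.
Proof.
move=> dab; apply/idP/idP => [da|db].
  by have := dvdz_subr da dab; congr (_ %| _)%Z; lia.
by have := dvdz_addr dab db; congr (_ %| _)%Z; lia.
Qed.

Lemma dvdz_congrD (d : nat) (a b a' b' c : int) : (d %| (c - (a' + b'))%R)%Z ->
  (d %| (a - a')%R)%Z -> (d %| (b - b')%R)%Z -> (d %| (c - (a + b))%R)%Z.
Proof.
move=> cab aa bb; have := dvdz_subr cab (dvdz_addr aa bb).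
by congr (_ %| _)%Z; lia.
Qed.

Lemma dvdz_sym (d : nat) (a b : int) : (d %| (a - b)%R)%Z = (d %| (b - a)%R)%Z.
Proof. by rewrite -opprB rpredN. Qed.

Lemma dvdz_trans_sub (d : nat) (a b c : int) :
  (d %| (a - b)%R)%Z -> (d %| (b - c)%R)%Z -> (d %| (a - c)%R)%Z.
Proof. by move=> ab bc; have := dvdz_addr ab bc; congr (_ %| _)%Z; lia. Qed.

Section DyerLength.
Context {n : nat} (g : marked_group n).
Context (f : 'I_n -> natbar) (m : 'I_n -> 'I_n -> natbar).
Hypotheses (fm : dyer_data f m) (gP : presented_by g (dyer_relators f m)).
Implicit Types (i j : 'I_n) (w u v : seq (letter n)) (x y z t : g) (a b : letter n).
Implicit Types (T U : {set 'I_n}).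

Local Notation s := (@mg_gen n g).
Local Notation ev := (word_eval s).
Local Notation wall := (option 'I_n * g)%type.
Local Notation len := (word_length (@mg_spans n g)).
Local Notation wall_of := (wall_of g f).
Implicit Types p q : wall.

Lemma len_ev w : (len (ev w) <= size w)%N.
Proof. by apply/word_ballP; exists w. Qed.

Lemma ex_geodesic x : exists2 w, size w = len x & ev w = x.
Proof.
by rewrite /word_length; case: ex_minnP => k /asboolP[w wk wx] _; exists w.
Qed.

Lemma lenM x y : (len (x * y) <= len x + len y)%N.
Proof.
have [u <- ux] := ex_geodesic x; have [v <- vy] := ex_geodesic y.
by rewrite -ux -vy -ev_cat -size_cat len_ev.
Qed.

Lemma len_eq0 x : len x = 0%N -> x = 1.
Proof. by have [w <- <-] := ex_geodesic x => /size0nil ->. Qed.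

Lemma lenV x : len x^-1 = len x.
Proof.
have le y : (len y^-1 <= len y)%N.
  have [w <- <-] := ex_geodesic y.
  by rewrite -ev_finv (leq_trans (len_ev _)) // /Defs.finv size_rev size_map.
by apply/eqP; rewrite eqn_leq le /= -{1}(invgK x) le.
Qed.

Definition over T w : bool := all (fun a => a.1 \in T) w.
Definition parabolic T : set g := [set x | exists2 w, over T w & ev w = x].

Lemma over_cat T u v : over T (u ++ v) = over T u && over T v.
Proof. exact: all_cat. Qed.
Lemma over_uncross T w p : over T w -> over T (uncross f w p).
Proof.
elim: w p => //= a w IH p /andP[aT /IH wT].
by case: eqP => _ //=; rewrite aT wT.
Qed.
Lemma over_finv T w : over T w -> over T (Defs.finv w).
Proof. by rewrite /over /Defs.finv all_rev all_map. Qed.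

Lemma par1 T : parabolic T 1. Proof. by exists [::]. Qed.
Lemma parM T x y : parabolic T x -> parabolic T y -> parabolic T (x * y).
Proof.
by move=> [u uT <-] [v vT <-]; exists (u ++ v); rewrite ?over_cat ?uT ?ev_cat.
Qed.
Lemma parV T x : parabolic T x -> parabolic T x^-1.
Proof. by move=> [u uT <-]; exists (Defs.finv u); rewrite ?over_finv ?ev_finv. Qed.
Lemma par_gen T i : i \in T -> parabolic T (s i).
Proof. by move=> iT; exists [:: (i, false)]; rewrite /= ?iT // mulg1. Qed.
Lemma parX T x k : parabolic T x -> parabolic T (x ^+ k).
Proof. by move=> xT; elim: k => [|k IH]; [exact: par1 | rewrite expgS; exact: parM]. Qed.
Lemma par_zpow T x (k : int) : parabolic T x -> parabolic T (zpow x k).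
Proof. by move=> xT; case: k => k /=; [|apply: parV]; exact: parX. Qed.
Lemma parJ T x y : parabolic T x -> parabolic T y -> parabolic T (x ^ y).
Proof. by move=> xT yT; rewrite conjgE; apply: parM; [exact: parV|exact: parM]. Qed.
Lemma par_lt T a : a.1 \in T -> parabolic T (lt_eval g a).
Proof. by move=> aT; rewrite lt_evalE; apply: par_zpow; exact: par_gen. Qed.
Lemma parS T U : T \subset U -> parabolic T `<=` parabolic U.
Proof.
move=> /fintype.subsetP TU x [w wT <-]; exists w => //.
by apply: sub_all wT => a /TU.
Qed.

(** * Separation by walls and geodesic words *)

Definition power_word i (k : int) : seq (letter n) := nseq `|k| (i, (k < 0)%R).

Lemma ev_power_word i (k : int) : ev (power_word i k) = zpow (s i) k.
Proof.
rewrite /power_word; case: k => k /=.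
  by elim: k => //= k ->; rewrite expgS.
suff E l : ev (nseq l (i, true)) = s i ^- l by rewrite -E.
by elim: l => [|l IH]; rewrite ?invg1 //= IH expgSr invgM.
Qed.

Lemma over_power_word T i k : i \in T -> over T (power_word i k).
Proof. by move=> iT; rewrite /over all_nseq iT orbT. Qed.

(** Computed on an arbitrary word for [x], hence meaningful only modulo the order of the wall. The
    norm [sep] of the residue does not depend on the word, and every word for [x] crosses [p] at
    least that often. *)
Definition cross x p : int := crossings f (projT1 (cid (mg_spans x))) p.
Definition sep x p : nat := cyclic_norm (wall_order f p.1) (cross x p).

Lemma cross_ev w p : (wall_order f p.1 %| (cross (ev w) p - crossings f w p)%R)%Z.
Proof.
by rewrite /cross; case: cid => /= w' ww'; apply: (eq_crossings fm gP).
Qed.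

Lemma sep_ev w p : sep (ev w) p = cyclic_norm (wall_order f p.1) (crossings f w p).
Proof. exact/eq_cyclic_norm/cross_ev. Qed.

Lemma crossM x y p :
  (wall_order f p.1 %| (cross (x * y)%g p - (cross x p + cross y (wallJ p x)))%R)%Z.
Proof.
have [u ux] := mg_spans x; have [v vy] := mg_spans y.
have A := cross_ev (u ++ v) p; have B := cross_ev u p.
have C := cross_ev v (wallJ p x).
move: A; rewrite ev_cat crossings_cat ux vy => A; rewrite ux in B; rewrite vy in C.
exact: dvdz_congrD A B C.
Qed.

Lemma sep_le w p : (sep (ev w) p <= count_cross f w p)%N.
Proof.
rewrite sep_ev; apply: leq_trans (crossings_le f w p).
by apply: cyclic_norm_le; rewrite subrr dvdz0.
Qed.

(** No wall is crossed more often than the value of the word forces. This turns out to characterize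
    geodesics. *)
Definition tight w : Prop := forall p, count_cross f w p = sep (ev w) p.

Lemma tight_len w : tight w -> size w = len (ev w).
Proof.
move=> tw; apply/eqP; rewrite eqn_leq len_ev andbT.
have [w' <- w'w] := ex_geodesic (ev w); apply: (@size_le_count_cross _ g f).
by move=> p; rewrite tw -w'w sep_le.
Qed.

Lemma count_cross0 w p : count_cross f w p = 0%N -> crossings f w p = 0%R.
Proof. by move=> w0; apply/eqP; rewrite -absz_eq0 -leqn0 -w0 crossings_le. Qed.

Lemma first_crossing w p : (0 < count_cross f w p)%N ->
  exists u a v, [/\ w = u ++ a :: v, wallJ p (ev u) = wall_of a.1
    & count_cross f u p = 0%N].
Proof.
elim: w p => //= a w IH p; case: (eqVneq p (wall_of a.1)) => [pa _|pa].
  by exists [::], a, w; rewrite wallJ1.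
rewrite add0n => /IH[u [b [v [-> ub u0]]]]; exists (a :: u), b, v.
by rewrite ev_cons wallJM /= (negPf pa).
Qed.

(** If [w] crosses a wall too often, gather all these crossings at the first one, where they form a
    power of a generator, and reduce the exponent modulo its order: the word gets shorter and stays
    over [T]. Since tight words are geodesic, words that are shortest among those over [T] are
    shortest among all words. *)
Lemma minimal_tight T w : over T w ->
  (forall w', over T w' -> ev w' = ev w -> (size w <= size w')%N) -> tight w.
Proof.
move=> wT wmin p; apply/eqP; rewrite eqn_leq sep_le andbT leqNgt; apply/negP => lt.
have [u [a [v [wE pa u0]]]] := first_crossing (leq_trans (ltn0Sn _) lt).
have [b bw bs] := cyclic_norm_ex (wall_order f p.1) (crossings f w p).
have pE : p.1 = color f a.1 by rewrite -[p.1]/((wallJ p (ev u)).1) pa.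
pose w' := u ++ power_word a.1 b ++ uncross f (a :: v) (wall_of a.1).
have crE : crossings f w p = crossings f (a :: v) (wall_of a.1).
  by rewrite wE crossings_cat count_cross0 // add0r pa.
have coE : count_cross f w p = count_cross f (a :: v) (wall_of a.1).
  by rewrite wE count_cross_cat u0 add0n pa.
have /wmin : over T w'.
  move: wT; rewrite wE over_cat => /andP[uT avT].
  rewrite !over_cat uT over_power_word ?over_uncross //.
  by case/andP: avT.
have /[swap] /[apply] : ev w' = ev w.
  rewrite wE !ev_cat ev_power_word (uncrossP f (a :: v) (color f a.1) (s a.1)).
  congr (_ * (_ * _)); rewrite -/(wall_of a.1) -crE.
  apply: (@eq_zpow _ _ (wall_order f p.1)) => //.
  by rewrite pE (wall_order_color fm) (genX_order gP).
have := size_uncross f (a :: v) (wall_of a.1).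
have wl : size w = (size u + size (a :: v))%N by rewrite wE size_cat.
rewrite -coE wl !size_cat size_nseq bs -sep_ev; move: lt; lia.
Qed.

Lemma geodesic_tight w : size w = len (ev w) -> tight w.
Proof.
move=> wg; apply: (@minimal_tight finset.setT); first by apply/allP => a _; rewrite inE.
by move=> w' _ w'w; rewrite wg -w'w len_ev.
Qed.

Lemma par_tight T x : parabolic T x -> exists w, [/\ over T w, ev w = x & tight w].
Proof.
move=> [w0 w0T w0x].
pose P k := `[< exists w, [/\ over T w, ev w = x & size w = k] >].
have exP : exists k, P k by exists (size w0); apply/asboolP; exists w0.
case: (ex_minnP exP) => k /asboolP[w [wT wx wk]] kmin.
exists w; split => //; apply: (minimal_tight wT) => w' w'T w'w.
by rewrite wk; apply: kmin; apply/asboolP; exists w'; rewrite w'w.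
Qed.

Lemma geodesic_catl u v : size (u ++ v) = len (ev (u ++ v)) -> size u = len (ev u).
Proof.
rewrite size_cat ev_cat => uv; have := lenM (ev u) (ev v).
by have := len_ev u; have := len_ev v; rewrite -uv; lia.
Qed.

Lemma geodesic_catr u v : size (u ++ v) = len (ev (u ++ v)) -> size v = len (ev v).
Proof.
rewrite size_cat ev_cat => uv; have := lenM (ev u) (ev v).
by have := len_ev u; have := len_ev v; rewrite -uv; lia.
Qed.

(** Deleting from a geodesic the letters that cross [p] amounts to multiplying on the left by a
    power of the conjugate underlying [p]. *)
Lemma sep_shorten x p : exists2 k : int, (wall_order f p.1 %| (k + cross x p)%R)%Z
  & (len (zpow p.2 k * x) + sep x p <= len x)%N.
Proof.
have [w wl wx] := ex_geodesic x.
have tw : tight w by apply: geodesic_tight; rewrite wx.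
exists (- crossings f w p)%R; first by rewrite addrC -wx cross_ev.
case: p => c t; rewrite -{1}wx (uncrossP f w c t) zpowN mulKg.
rewrite -wl -(size_uncross f w (c, t)) (tw (c, t)) wx leq_add2r; exact: len_ev.
Qed.

Definition desc i x : bool := sep x (wall_of i) != 0%N.

Lemma descE i x : desc i x = ~~ (wall_order f (color f i) %| cross x (wall_of i))%Z.
Proof. by rewrite /desc /sep cyclic_norm_eq0. Qed.

Lemma desc_first T z : parabolic T z -> z <> 1 -> exists2 i, i \in T & desc i z.
Proof.
move=> /par_tight[[|a w] [wT <- tw]] // _; case/andP: wT => aT _.
by exists a.1 => //; rewrite /desc -tw /= eqxx.
Qed.

(** * Minimal representatives of cosets of parabolic subgroups *)

Definition coset_min T y : Prop := forall z, parabolic T z -> (len y <= len (z * y))%N.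

(** Otherwise a power of [t] would shorten [y] inside its coset. *)
Lemma coset_min_sep T y c t : coset_min T y -> parabolic T t -> sep y (c, t) = 0%N.
Proof.
move=> ymin tT; have [k _ /= le] := sep_shorten y (c, t).
apply/eqP; rewrite -leqn0 -(leq_add2l (len (zpow t k * y))) addn0.
exact: leq_trans le (ymin _ (par_zpow k tT)).
Qed.

Lemma wall_par T w c t : over T w -> (0 < count_cross f w (c, t))%N -> parabolic T t.
Proof.
elim: w t => //= a w IH t /andP[aT wT]; case: eqP => [[_ ->] _|_].
  exact: par_gen.
rewrite add0n => /(IH _ wT) /= tT.
rewrite -(conjgK (lt_eval g a) t); apply: parJ => //; apply: parV; exact: par_lt.
Qed.

Lemma tight_cat u v : tight u -> tight v ->
  (forall p, count_cross f u p = 0 \/ count_cross f v (wallJ p (ev u)) = 0)%N ->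
  tight (u ++ v).
Proof.
move=> tu tv uv p; rewrite sep_ev count_cross_cat crossings_cat.
case: (uv p) => /[dup] e0 ->; rewrite (count_cross0 e0).
  by rewrite add0n add0r tv sep_ev.
by rewrite addn0 addr0 tu sep_ev.
Qed.

(** A word over [T] for [z] crosses only walls lying in the parabolic subgroup, and [y] crosses none
    of those, even after conjugation by [z]. So tight words for [z] and [y] concatenate to a tight
    word. *)
Lemma coset_min_len T y z : coset_min T y -> parabolic T z ->
  len (z * y) = (len z + len y)%N.
Proof.
move=> ymin zT; have [u [uT uz tu]] := par_tight zT.
have [v vl vy] := ex_geodesic y.
have tv : tight v by apply: geodesic_tight; rewrite vy.
suff /tight_len : tight (u ++ v).
  by rewrite size_cat ev_cat uz vy (tight_len tu) uz vl => ->.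
apply: tight_cat => // -[c t]; have [->|] := posnP (count_cross f u (c, t)); first by left.
move=> /(wall_par uT) tT; right; rewrite tv vy.
by apply: (coset_min_sep _ ymin); apply: parJ; rewrite ?uz.
Qed.

Lemma coset_min_desc T y z i : coset_min T y -> parabolic T z -> i \in T ->
  desc i (z * y) = desc i z.
Proof.
move=> ymin zT iT; rewrite !descE; congr (~~ _).
have yz : (wall_order f (color f i) %| cross y (wallJ (wall_of i) z))%Z.
  rewrite -cyclic_norm_eq0; apply/eqP; apply: (coset_min_sep _ ymin).
  by apply: parJ => //; exact: par_gen.
have E := crossM z y (wall_of i).
apply: dvdz_congr; rewrite -(addr0 (cross z _)).
by apply: dvdz_congrD E _ _; rewrite ?subrr ?dvdz0 // sub0r rpredN.
Qed.

Lemma ex_coset_min T x :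
  exists z y, [/\ parabolic T z, coset_min T y & x = z * y].
Proof.
pose P k := `[< exists2 z, parabolic T z & len (z * x) = k >].
have exP : exists k, P k.
  by exists (len (1 * x)); apply/asboolP; exists 1 => //; exact: par1.
case: (ex_minnP exP) => k /asboolP[z zT zk] kmin.
exists z^-1, (z * x); split; [exact: parV| |by rewrite mulKg].
move=> z' z'T; rewrite zk; apply: kmin; apply/asboolP; exists (z' * z).
  exact: parM.
by rewrite mulgA.
Qed.

(** Write [y = z * y0] with [y0] minimal: if [z] is not 1 it has a descent in [T], which is then a
    descent of [y]. *)
Lemma coset_minP T y : coset_min T y <-> (forall i, i \in T -> ~~ desc i y).
Proof.
split=> [ymin i iT|nd].
  by rewrite /desc negbK; apply/eqP; apply: (coset_min_sep _ ymin); exact: par_gen.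
have [z [y0 [zT y0min yE]]] := ex_coset_min T y.
have [z1|/eqP z1] := eqVneq z 1; first by rewrite yE z1 mul1g.
have [i iT iz] := desc_first zT z1.
by have := nd i iT; rewrite yE (coset_min_desc y0min) ?iz.
Qed.

(** Each of [y], [y'] is the other one multiplied by [z'^-1 * z] or its inverse, and lengths add in
    both products, so this factor has length 0. *)
Lemma coset_min_uniq T y y' z z' : coset_min T y -> coset_min T y' ->
  parabolic T z -> parabolic T z' -> z * y = z' * y' -> z = z' /\ y = y'.
Proof.
move=> ymin y'min zT z'T e.
have yE : y' = (z'^-1 * z) * y by rewrite -mulgA e mulKg.
have zzT : parabolic T (z'^-1 * z) by apply: parM => //; exact: parV.
have y'E : y = (z'^-1 * z)^-1 * y' by rewrite yE mulKg.
have := coset_min_len ymin zzT; have := coset_min_len y'min (parV zzT).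
rewrite -yE -y'E lenV => l1 l2.
have /len_eq0 z1 : len (z'^-1 * z) = 0%N by move: l1 l2; lia.
by move: yE; rewrite z1 mul1g; split=> //; rewrite -(mulVKg z' z) z1 mulg1.
Qed.

(** * Tags, and elements having every generator of a set as a descent *)

Lemma count_cross_color w p : (forall a, a \in w -> color f a.1 <> p.1) ->
  count_cross f w p = 0%N.
Proof.
elim: w p => //= a w IH p wc; rewrite IH; last by move=> b bw; apply: wc; rewrite inE bw orbT.
by case: eqP => // pa; case: (wc a); rewrite ?mem_head // pa.
Qed.

Lemma cross_color T x p : parabolic T x -> (forall i, i \in T -> color f i <> p.1) ->
  (wall_order f p.1 %| cross x p)%Z.
Proof.
move=> [w wT <-] Tc; rewrite (dvdz_congr (cross_ev w p)) count_cross0 ?dvdz0 //.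
by apply: count_cross_color => a /(allP wT) /Tc.
Qed.

Lemma cross_lt a p :
  (wall_order f p.1 %| (cross (lt_eval g a) p - (if p == wall_of a.1 then sgn a else 0))%R)%Z.
Proof. by have := cross_ev [:: a] p; rewrite ev_seq1 /= addr0. Qed.

Lemma cross_comm x y i : commute (s i) x ->
  (wall_order f (color f i) %|
    (cross (x * y)%g (wall_of i) - (cross x (wall_of i) + cross y (wall_of i)))%R)%Z.
Proof. by move=> ix; have := crossM x y (wall_of i); rewrite wallJ_fix. Qed.

Lemma par_commute T x t : (forall i, i \in T -> commute (s i) t) ->
  parabolic T x -> commute x t.
Proof.
move=> Tt [w wT <-]; elim: w wT => [_|a w IH /andP[/Tt aT /IH wt]].
  exact/commute_sym/commute1.
rewrite ev_cons; apply: commute_sym; apply: commuteM; apply: commute_sym => //.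
by rewrite lt_evalE; exact: zpow_commute.
Qed.

(** Such an [x] behaves like the longest element of a Coxeter group: every [z] of the parabolic
    subgroup is a prefix of it. Induction on a geodesic [a :: w] of [z], with [z'] the value of [w]
    and [x = z' * v]: the first letter already crosses the wall of [a], so [z'] does not cross it
    modulo 2, while [x] does. Hence [v] crosses its conjugate by [z'], and the corresponding
    reflection shortens [v]. *)
Lemma small_full_prefix T x z : (forall i, i \in T -> ~~ big f i) ->
  (forall i, i \in T -> desc i x) -> parabolic T z -> (len (z^-1 * x) + len z <= len x)%N.
Proof.
move=> Tsmall xfull /par_tight[w [wT <- tw]]; rewrite -(tight_len tw).
have {tw} := tight_len tw; elim: w wT => [_ _|a w IH /andP[aT wT] wl].
  by rewrite invg1 mul1g addn0.
have tw := geodesic_tight wl.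
have /(IH wT) {IH} := @geodesic_catr [:: a] w wl.
set z' := ev w; set v := z'^-1 * x => lev.
have xE : x = z' * v by rewrite mulVKg.
have co : color f a.1 = None by rewrite /color (negPf (Tsmall _ aT)).
have w0 : count_cross f w (wall_of a.1) = 0%N.
  have := tw (wall_of a.1); rewrite /= eqxx wallJ_fix; last exact: lt_commute.
  rewrite /sep /= co /=; set k := cross _ _; set c := count_cross _ _ _.
  have : (cyclic_norm 2 k <= `|(k %% 2)%Z|)%N.
    by apply: cyclic_norm_le; rewrite -eqz_mod_dvd modz_mod.
  by lia.
have cz' : (2 %| cross z' (wall_of a.1))%Z.
  have := cross_ev w (wall_of a.1); rewrite (count_cross0 w0) subr0 -/z' /=.
  by rewrite co.
have cv : ~~ (2 %| cross v (wallJ (wall_of a.1) z'))%Z.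
  apply/negP => cv; have := xfull _ aT; rewrite descE co /= => /negP; apply.
  have := crossM z' v (wall_of a.1); rewrite -xE /= co => E.
  by rewrite (dvdz_congr E) rpredD.
have [k] := sep_shorten v (wallJ (wall_of a.1) z').
rewrite /= co /= => dk.
have -> : zpow (s a.1 ^ z') k = s a.1 ^ z'.
  have t2 : (s a.1 ^ z') ^+ 2 = 1.
    by rewrite -conjXg expg2 (small_square fm gP (Tsmall _ aT)) conj1g.
  by rewrite (@eq_zpow _ _ 2 k 1 t2) //; move: dk cv; lia.
have : (0 < sep v (wallJ (wall_of a.1) z'))%N.
  by rewrite lt0n /sep cyclic_norm_eq0 /= co.
have -> : s a.1 ^ z' * v = (lt_eval g a * z')^-1 * x.
  have aV : (lt_eval g a)^-1 = s a.1.
    have aa := mulg1_eq (small_square fm gP (Tsmall _ aT)).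
    by rewrite /lt_eval; case: (a.2); rewrite ?invgK.
  by rewrite invgM aV conjgE xE !mulgA.
rewrite -[X in _ -> _ -> (len (X^-1 * x) + _ <= _)%N]/(lt_eval g a * z').
by move: lev; move: (len (_ * x)) (len v) (sep v _) => l1 l2 l3; lia.
Qed.

Definition full T : set g :=
  [set x | parabolic T x /\ forall i, i \in T -> desc i x].

(** Each of the two elements is a prefix of the other. *)
Lemma small_full_uniq T x x' : (forall i, i \in T -> ~~ big f i) ->
  full T x -> full T x' -> x = x'.
Proof.
move=> Tsmall [xT xd] [x'T x'd].
have := small_full_prefix Tsmall xd x'T; have := small_full_prefix Tsmall x'd xT.
rewrite -[x^-1 * x']invgK lenV invgM invgK => l1 l2.
have /len_eq0 e : len (x'^-1 * x) = 0%N by move: l1 l2; lia.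
by rewrite -(mulVKg x' x) e mulg1.
Qed.


(** * Descents of order at least 3 *)

Lemma color_neq i j : big f i -> i != j -> color f i <> color f j.
Proof. by move=> bi ij; rewrite /color bi; case: ifP => // _ [] /eqP; rewrite (negPf ij). Qed.

Lemma tight_desc w i : tight w -> (0 < count_cross f w (wall_of i))%N -> desc i (ev w).
Proof. by move=> tw; rewrite /desc -tw lt0n. Qed.

Lemma cross_mul_color T x y p : parabolic T y -> (forall i, i \in T -> color f i <> p.1) ->
  (wall_order f p.1 %| (cross (x * y)%g p - cross x p)%R)%Z.
Proof.
move=> yT Tc; rewrite -(addr0 (cross x p)).
apply: dvdz_congrD (crossM x y p) _ _; first by rewrite subrr dvdz0.
by rewrite sub0r rpredN; exact: (cross_color (p := wallJ p x) yT).
Qed.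

Lemma cross_rcons i y d : commute y (s i) -> ~~ desc i y ->
  (wall_order f (color f i) %| (cross (y * lt_eval g (i, d))%g (wall_of i) - sgn (i, d))%R)%Z.
Proof.
move=> yi; rewrite descE negbK => yd; rewrite -(add0r (sgn _)).
apply: dvdz_congrD (cross_comm _ (commute_sym yi)) _ _; first by rewrite sub0r rpredN.
by have := cross_lt (i, d) (wall_of i); rewrite /= eqxx dvdz_sym.
Qed.

Lemma desc_ev i w : desc i (ev w) = ~~ (wall_order f (color f i) %| crossings f w (wall_of i))%Z.
Proof. by rewrite /desc sep_ev cyclic_norm_eq0. Qed.

(** Take a geodesic of [x] starting with a power of [s j] and cut it just after its first crossing
    of the wall of [i]. The piece still has both descents, so by minimality it is everything. The
    prefix [h] before the cut fixes the wall of [i], that is, commutes with [s i]. *)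
Lemma minimal_desc2 i j x : color f i <> color f j ->
  parabolic [set i; j]%SET x -> desc i x -> desc j x ->
  (forall y, parabolic [set i; j]%SET y -> desc i y -> desc j y -> (len x <= len y)%N) ->
  exists (b : bool) (h : g), [/\ x = h * lt_eval g (i, b), commute h (s i), parabolic [set i; j]%SET h,
    len x = (len h).+1 & desc j h].
Proof.
move=> cij xT di dj xmin; have [w0 [w0T w0x tw0]] := par_tight xT.
have [k kw ks] := cyclic_norm_ex (wall_order f (color f j)) (crossings f w0 (wall_of j)).
pose w := power_word j k ++ uncross f w0 (wall_of j).
have jT : j \in [set i; j]%SET by rewrite !inE eqxx orbT.
have wT : over [set i; j]%SET w by rewrite over_cat over_power_word // over_uncross.
have wx : ev w = x.
  rewrite ev_cat ev_power_word -w0x (uncrossP f w0 (color f j) (s j)).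
  congr (_ * _); apply: (@eq_zpow _ _ (wall_order f (color f j))) => //.
  by rewrite (wall_order_color fm) (genX_order gP).
have sj : `|k|%N = sep x (wall_of j) by rewrite ks -w0x sep_ev.
have wl : size w = len (ev w).
  rewrite wx -w0x -(tight_len tw0) -(size_uncross f w0 (wall_of j)) size_cat.
  by rewrite size_nseq sj tw0 w0x addnC.
have [c [w1 wE]] : exists c w1, w = (j, c) :: w1.
  have : (0 < `|k|)%N by rewrite sj lt0n.
  rewrite /w /power_word; case: `|k|%N => // l _ /=.
  by eexists; eexists.
have tw := geodesic_tight wl.
have : (0 < count_cross f w (wall_of i))%N by rewrite tw wx lt0n.
move=> /first_crossing[u [a [v [wE' ia u0]]]].
have ca : color f a.1 = color f i by rewrite -[LHS]/((wall_of a.1).1) -ia.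
have {ca} ai : a.1 = i.
  have : a.1 \in [set i; j]%SET.
    by apply: (allP wT); rewrite wE' mem_cat mem_head orbT.
  by rewrite !inE => /orP[/eqP //|/eqP aj]; case: cij; rewrite -ca aj.
have {}ia : commute (ev u) (s i).
  move: ia; rewrite ai => -[]; rewrite conjgE => e.
  by rewrite /commute -{1}e mulVKg.
have [u' uE] : exists u', u = (j, c) :: u'.
  move: wE'; rewrite wE; case: (u) => [[aE _]|b u' [-> _]]; last by exists u'.
  by case: cij; rewrite -ai -aE.
have ju v' : (0 < count_cross f (u ++ v') (wall_of j))%N by rewrite uE /= eqxx.
have uT : over [set i; j]%SET u by move: wT; rewrite wE' over_cat => /andP[].
have iT : i \in [set i; j]%SET by rewrite !inE eqxx.
have l1 : size (u ++ [:: a]) = len (ev (u ++ [:: a])).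
  by apply: (@geodesic_catl _ v); rewrite -catA cat1s -wE'.
have t1 := geodesic_tight l1.
have : (len x <= len (ev (u ++ [:: a])))%N.
  apply: xmin; [|apply: tight_desc => //|exact: tight_desc].
    by exists (u ++ [:: a]) => //; rewrite over_cat uT /= ai iT.
  by rewrite count_cross_cat /= wallJ_fix ?ai ?eqxx ?addn1 //; exact: commute_sym.
rewrite -l1 -{1}wx -wl wE' !size_cat /= => lv.
have v0 : v = [::] by apply: size0nil; move: lv; lia.
have lu : size u = len (ev u) by exact: geodesic_catl l1.
exists a.2, (ev u); split => //.
- by rewrite -wx wE' v0 ev_cat ev_seq1 /lt_eval ai.
- by exists u.
- by rewrite -wx -wl wE' v0 size_cat /= addn1 lu.
- by apply: tight_desc; [exact: geodesic_tight | rewrite -(cats0 u)].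
Qed.

(* Among the elements of the subgroup generated by [s_i] and [s_j] having both descents,
   a shortest one is [x = h * s_i^e] with [h] commuting with [s_i], and [h * s_i^-e] is
   another one.  Comparing both with their expressions ending in [s_j] shows that
   [s_i^2] commutes with [s_j]; then [x] has length at most 3. *)
Lemma desc_commute i j x : big f i -> i != j -> desc i x -> desc j x ->
  commute (s i) (s j).
Proof.
move=> bi ij di dj; have cij := color_neq bi ij; have cji : color f j <> color f i by move=> /esym.
set P := [set i; j]%SET; have PE : P = [set j; i]%SET by rewrite /P finset.setUC.
have iP : i \in P by rewrite !inE eqxx.
have jP : j \in P by rewrite !inE eqxx orbT.
pose both y := [/\ parabolic P y, desc i y & desc j y].
(* Passing to the parabolic factor of [x] keeps both descents, so the search takes place in the
   subgroup generated by [s i] and [s j]. *)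
have exB : exists k, `[< exists2 y, both y & len y = k >].
  have [z [y [zP ymin xE]]] := ex_coset_min P x.
  exists (len z); apply/asboolP; exists z => //.
  by split => //; [rewrite -(coset_min_desc ymin zP iP) -xE | rewrite -(coset_min_desc ymin zP jP) -xE].
case: (ex_minnP exB) => k /asboolP[{x di dj}x [xP di dj] xk] kmin.
have {kmin exB} xmin y : parabolic P y -> desc i y -> desc j y -> (len x <= len y)%N.
  by move=> yP iy jy; rewrite xk; apply: kmin; apply/asboolP; exists y.
have [b [h [xh hi hP hl dh]]] := minimal_desc2 cij xP di dj xmin.
have dih : ~~ desc i h by apply/negP => /(xmin h hP) /(_ dh); rewrite hl ltnn.
have xmin' y : parabolic [set j; i]%SET y -> desc j y -> desc i y -> (len x <= len y)%N.
  by rewrite -PE => yP dj' di'; exact: xmin.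
have xP' := xP; rewrite PE in xP'.
have [c [h1 [xh1 h1j h1P h1l dh1]]] := minimal_desc2 cji xP' dj di xmin'.
rewrite -PE in h1P.
have djh1 : ~~ desc j h1 by apply/negP => /(xmin h1 h1P dh1); rewrite h1l ltnn.
pose x2 := h * lt_eval g (i, ~~ b).
have ltV : lt_eval g (i, ~~ b) = (lt_eval g (i, b))^-1.
  by rewrite /lt_eval /=; case: b {xh x2} => /=; rewrite ?invgK.
have ci y d : commute y (s i) -> ~~ desc i y ->
    (wall_order f (color f i) %| (cross (y * lt_eval g (i, d))%g (wall_of i) - sgn (i, d))%R)%Z.
  exact: cross_rcons.
have cj y d : (wall_order f (color f j) %|
    (cross (y * lt_eval g (i, d))%g (wall_of j) - cross y (wall_of j))%R)%Z.
  apply: (@cross_mul_color [set i]%SET); first by apply: par_lt; rewrite inE.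
  by move=> l; rewrite inE => /eqP ->.
have x2P : parabolic P x2 by apply: parM => //; exact: par_lt.
have dj2 : desc j x2.
  by move: dh; rewrite !descE (dvdz_congr (cj _ _)).
have o1 (d : bool) : ~~ (wall_order f (color f i) %| sgn (i, d))%Z.
  rewrite /sgn /=; have := big_order fm bi.
  by case: (wall_order _ _) => [|[|[|o]]] [] // _; case: d; rewrite ?dvdz1.
have di2 : desc i x2 by rewrite descE (dvdz_congr (ci _ _ hi dih)).
have l2 : (len x2 <= len x)%N.
  rewrite hl (leq_trans (lenM _ _)) // -addn1 leq_add2l -ev_seq1.
  exact: len_ev.
have x2min y : parabolic [set j; i]%SET y -> desc j y -> desc i y -> (len x2 <= len y)%N.
  by move=> yP jy iy; apply: leq_trans l2 (xmin' _ yP jy iy).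
have x2P' := x2P; rewrite PE in x2P'.
have [c2 [h2 [xh2 h2j h2P h2l dh2]]] := minimal_desc2 cji x2P' dj2 di2 x2min.
rewrite -PE in h2P.
have djh2 : ~~ desc j h2.
  apply/negP => /(xmin h2 h2P dh2); apply/negP; rewrite -ltnNge.
  by apply: leq_trans l2; rewrite h2l.
(* [x] and [x2] differ only by a final power of [s i], which crosses no wall with the tag of [j]; so
   they cross the wall of [j] equally often modulo its order, and this residue is the exponent of
   the last letter. *)
have cc : lt_eval g (j, c) = lt_eval g (j, c2).
  rewrite !lt_evalE /=; apply: (@eq_zpow _ _ (wall_order f (color f j))).
    by rewrite (wall_order_color fm) (genX_order gP).
  have := cross_rcons c h1j djh1; rewrite -xh1 xh dvdz_sym => A.
  have := cross_rcons c2 h2j djh2; rewrite -xh2 => B.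
  apply: dvdz_trans_sub A (dvdz_trans_sub (cj _ _) _).
  by apply: dvdz_trans_sub B; rewrite dvdz_sym; exact: cj.
(* [h1] and [h2] commute with [s j], and [h2 * h1^-1 = x2 * x^-1] is the inverse of this square
   because [h] commutes with [s i]. *)
have sq : commute (lt_eval g (i, b) * lt_eval g (i, b)) (s j).
  have -> : lt_eval g (i, b) * lt_eval g (i, b) = (h2 * h1^-1)^-1.
    have -> : h1 = x * (lt_eval g (j, c))^-1 by rewrite xh1 mulgK.
    have -> : h2 = x2 * (lt_eval g (j, c))^-1 by rewrite xh2 -cc mulgK.
    have hb : commute h (lt_eval g (i, b)).
      by apply: commute_sym; rewrite lt_evalE; apply: zpow_commute; exact: commute_sym.
    rewrite mulgKA /x2 ltV xh !(invgM, invgK) !mulgA hb -(mulgA _ h) hb.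
    by rewrite !mulgA mulgK.
  apply: commute_sym; apply: commuteV; apply: commuteM; first exact: commute_sym.
  by apply: commuteV; exact: commute_sym.
have sq2 : commute (s i ^+ 2) (s j).
  move: sq; rewrite /lt_eval /= expg2; case: (b) => // sq.
  apply: commute_sym; rewrite -(invgK (_ * _)); apply: commuteV; rewrite invgM.
  exact: commute_sym.
have wall_neq q l : q.1 <> color f l -> (q == wall_of l) = false.
  by move=> ql; apply/eqP => qE; apply: ql; rewrite qE.
have eij : s i ^+ 2 * s j = ev [:: (i, false); (i, false); (j, false)].
  by rewrite /= mulg1 mulgA.
have eji : s i ^+ 2 * s j = ev [:: (j, false); (i, false); (i, false)].
  by rewrite /= mulg1 sq2.
(* [s i ^+ 2 * s j] has both descents, as the order of [s i] is infinite or at least 3; minimality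
   gives [len x <= 3]. *)
have l3 : (len h1 <= 2)%N.
  rewrite -ltnS -h1l; apply: (@leq_trans (len (s i ^+ 2 * s j))).
    apply: xmin.
    - by apply: parM; [apply: parX|]; exact: par_gen.
    - rewrite eij desc_ev /=.
      rewrite eqxx !wallJ_fix // eqxx wall_neq // !addr0 /sgn /=.
      by have := big_order fm bi; case: (wall_order _ _) => [|[|[|o]]] [].
    - rewrite eji desc_ev /=.
      rewrite eqxx !wall_neq // !addr0 /sgn /= dvdz1.
      by have := wall_order_ge2 fm j; case: (wall_order _ _) => [|[|o]] [].
  rewrite eij; exact: len_ev.
have eX a : a.1 \in P -> a.1 = i \/ a.1 = j.
  by rewrite !inE => /orP[] /eqP; [left|right].
have [u [uP ux tu]] := par_tight h1P.
have : (0 < count_cross f u (wall_of i))%N by rewrite tu ux lt0n.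
move=> /first_crossing[v1 [a [v2 [uE va _]]]].
have al : a.1 = i.
  have ca : color f a.1 = color f i by rewrite -[LHS]/((wall_of a.1).1) -va.
  case: (eX a) => // [|aj]; last by case: cij; rewrite -ca aj.
  by apply: (allP uP); rewrite uE mem_cat mem_head orbT.
have ltc t a' : commute (lt_eval g a') t -> commute (s a'.1) t.
  rewrite /lt_eval; case: (a'.2) => // c'; apply: commute_sym; rewrite -(invgK (s _)).
  by apply: commuteV; exact: commute_sym.
have vc : commute (s i) (ev v1).
  move: va; rewrite al => -[]; rewrite conjgE => e; rewrite /commute -{2}e mulVKg //.
have aj : commute (lt_eval g a) (s j) -> commute (s i) (s j).
  by move=> /ltc; rewrite al.
(* Two letters in [i] have exponent sum 0 or 2 up to sign, which must be congruent to the sign of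
   the last letter of [x]. So the order divides 1, which is excluded, or 3, and then [s i] is a
   power of [s i ^+ 2]. *)
have odd_case (a1 a2 : letter n) : a1.1 = i -> a2.1 = i ->
    h1 = lt_eval g a1 * lt_eval g a2 -> commute (s i) (s j).
  move=> e1 e2 hE.
  have A := ci h b hi dih; rewrite -xh in A.
  have B : (wall_order f (color f i) %| (cross h1 (wall_of i) - cross x (wall_of i))%R)%Z.
    rewrite dvdz_sym xh1; apply: (@cross_mul_color [set j]%SET).
      by apply: par_lt; rewrite inE.
    by move=> l; rewrite inE => /eqP ->.
  have := dvdz_trans_sub B A.
  have h1E : h1 = ev [:: a1; a2] by rewrite hE /= mulg1.
  have C := cross_ev [:: a1; a2] (wall_of i); rewrite -h1E in C.
  rewrite dvdz_sym => D; have := dvdz_trans_sub D C.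
  rewrite /= e1 e2 eqxx -e1 wallJ_fix; last exact: lt_commute.
  rewrite e1 eqxx addr0 /sgn /=.
  have o3 : (wall_order f (color f i) %| 3)%Z -> commute (s i) (s j).
    have := big_order fm bi; have := genX_order gP i; rewrite -(wall_order_color fm).
    case: (wall_order _ _) => [|[|[|[|o]]]] // s3 [] // _.
      move=> _; have -> : s i = s i ^+ 2 * s i ^+ 2.
        by rewrite -expgnDr (expgnDr _ 3 1) s3 mul1g.
      by apply: commute_sym; apply: commuteM; exact: commute_sym.
  have o1' : (wall_order f (color f i) %| 1)%Z -> commute (s i) (s j).
    by move=> o; have := o1 false; rewrite /sgn /= o.
  case: (b); case: (a1.2); case: (a2.2) => /=; rewrite ?(dvdzE _ (Negz _)) //.
  all: try exact: o1'.
all: try exact: o3.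
have sz : (size v1 + size v2 <= 1)%N.
  by move: l3; rewrite -ux -(tight_len tu) uE size_cat /= addnS ltnS.
move: uE; case: v1 sz vc va {tu} => [|a1 [|//]]; case: v2 => [|a2 [|//]] // _ vc _ uE.
- by apply: aj; rewrite -ev_seq1 -[[:: a]]uE ux.
- have hE : h1 = lt_eval g a * lt_eval g a2 by rewrite -ux uE /= mulg1.
  case: (eX a2) => [||a2j]; first by apply: (allP uP); rewrite uE !inE eqxx orbT.
    by move=> a2i; exact: odd_case hE.
  apply: aj; have -> : lt_eval g a = h1 * (lt_eval g a2)^-1 by rewrite hE mulgK.
  apply: commute_sym; apply: commuteM; first exact: commute_sym.
  by apply: commuteV; rewrite -a2j; exact: lt_commute.
- have hE : h1 = lt_eval g a1 * lt_eval g a by rewrite -ux uE /= mulg1.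
  case: (eX a1) => [||a1j]; first by apply: (allP uP); rewrite uE !inE eqxx.
    by move=> a1i; exact: odd_case hE.
  apply: commute_sym; rewrite -a1j; apply: ltc; rewrite -ev_seq1.
  exact: commute_sym.
Qed.

(** The generators of [T] of order at least 3 commute with all of [T], so an element splits as
    [z * v] with [z] over these generators ([B]) and [v] over those of order 2 ([L]). Then [v] has
    all descents in [L] and is unique, while [z] is determined by its crossings of the walls of
    [B]. *)
Lemma full_uniq T x x' : full T x -> full T x' ->
  (forall i, i \in T -> big f i -> (wall_order f (color f i) %|
    (cross x (wall_of i) - cross x' (wall_of i))%R)%Z) -> x = x'.
Proof.
move=> [xT xd] [x'T x'd] xx'.
have Tc i j : i \in T -> big f i -> j \in T -> commute (s i) (s j).
  move=> iT bi jT; have [->|ij] := eqVneq i j; first exact: commute_refl.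
  exact: desc_commute bi ij (xd i iT) (xd j jT).
pose B := [set i in T | big f i]%SET; pose L := [set i in T | ~~ big f i]%SET.
have Bc y j : j \in T -> parabolic B y -> commute y (s j).
  by move=> jT; apply: par_commute => i; rewrite inE => /andP[iT bi]; exact: Tc.
have split y : parabolic T y -> exists z (v : g), [/\ parabolic B z, parabolic L v & y = z * v].
  move=> [w wT <-]; elim: w wT => [_|a w IH /andP[aT wT]].
    by exists 1, 1; split; [exact: par1|exact: par1|rewrite mulg1].
  have [z [v [zB vL wE]]] := IH wT; rewrite ev_cons wE.
  have [ba|sa] := boolP (big f a.1).
    exists (lt_eval g a * z), v; split => //; last by rewrite mulgA.
    by apply: parM => //; apply: par_lt; rewrite inE aT.
  exists z, (lt_eval g a * v); split => //.
    by apply: parM => //; apply: par_lt; rewrite inE aT.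
  have za : commute (lt_eval g a) z.
    by rewrite lt_evalE; apply: zpow_commute; apply: commute_sym; exact: Bc.
  by rewrite !mulgA za.
have crB y z (v : g) i : y = z * v -> parabolic B z -> parabolic L v -> i \in T -> big f i ->
    (wall_order f (color f i) %| (cross y (wall_of i) - cross z (wall_of i))%R)%Z.
  move=> -> zB vL iT bi; apply: (cross_mul_color _ (p := wall_of i) vL) => j.
  by rewrite inE => /andP[jT sj]; rewrite /= /color bi (negPf sj).
have fullL y z (v : g) : y = z * v -> parabolic B z -> parabolic L v ->
    (forall i, i \in T -> desc i y) -> full L v.
  move=> yE zB vL yd; split=> // i; rewrite inE => /andP[iT si].
  have := yd i iT; rewrite !descE; apply: contra => vi.
  have := cross_comm v (commute_sym (Bc z i iT zB)); rewrite -yE => E.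
  rewrite (dvdz_congr E) rpredD //.
  apply: (cross_color (p := wall_of i) zB) => j; rewrite inE => /andP[_ bj].
  by rewrite /= /color bj (negPf si).
have [z [v [zB vL xE]]] := split _ xT; have [z' [v' [zB' vL' xE']]] := split _ x'T.
have vv' : v = v'.
  apply: (@small_full_uniq L); first by move=> i; rewrite inE => /andP[].
    exact: fullL xE zB vL xd.
  exact: fullL xE' zB' vL' x'd.
suff zz' : z'^-1 * z = 1 by rewrite xE xE' -vv' -(mulVKg z' z) zz' mulg1.
have zzB : parabolic B (z'^-1 * z) by apply: parM => //; exact: parV.
apply/eqP; apply: contraT => /eqP /(desc_first zzB)[i iB].
have /andP[iT bi] : (i \in T) && big f i by move: iB; rewrite inE.
rewrite descE => /negP[].
have := cross_comm (z'^-1 * z) (commute_sym (Bc z' i iT zB')); rewrite mulVKg.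
set c := cross (z'^-1 * z) _ => E.
have {}E : (wall_order f (color f i) %|
    (cross z (wall_of i) - cross z' (wall_of i) - c)%R)%Z by rewrite -addrA -opprD.
rewrite -(dvdz_congr E).
apply: dvdz_trans_sub (dvdz_trans_sub (xx' i iT bi) (crB _ _ _ _ xE' zB' vL' iT bi)).
by rewrite dvdz_sym; exact: crB xE zB vL iT bi.
Qed.


End DyerLength.

Local Close Scope group_scope.
Local Open Scope ring_scope.

(** * Growth series *)

Section PowerSums.
Context {R : realType}.
Implicit Types (c : nat -> R) (t K : R) (N : nat).

(** For nonnegative coefficients and arguments, convergence of the power series is boundedness of
    its partial sums. The limit [psumoo] carries information only in that case. *)
Definition psum c N t : R := \sum_(k < N) c k * t ^+ k.
Definition psum_bounded c t : Prop := exists K, forall N, psum c N t <= K.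
Definition psumoo c t : R := limn (fun N => psum c N t).

Lemma psum_nondecreasing c t : (forall k, 0 <= c k) -> 0 <= t ->
  nondecreasing_seq (fun N => psum c N t).
Proof.
move=> c0 t0; apply/nondecreasing_seqP => N.
by rewrite /psum big_ord_recr /= lerDl mulr_ge0 // exprn_ge0.
Qed.

Lemma psum_ge0 c t N : (forall k, 0 <= c k) -> 0 <= t -> 0 <= psum c N t.
Proof. by move=> c0 t0; apply: sumr_ge0 => k _; rewrite mulr_ge0 // exprn_ge0. Qed.

Section Bounded.
Context (c : nat -> R) (t : R) (c0 : forall k, 0 <= c k) (t0 : 0 <= t).
Hypothesis ct : psum_bounded c t.

Lemma cvg_psum : psum c N t @[N --> \oo] --> psumoo c t.
Proof.
have [K cK] := ct; apply: cvgP; apply: nondecreasing_cvgn.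
  exact: psum_nondecreasing.
by exists K => _ [N _ <-].
Qed.

Lemma psum_le_psumoo N : psum c N t <= psumoo c t.
Proof.
apply: (@nondecreasing_cvgn_le _ (fun N => psum c N t)).
  exact: psum_nondecreasing.
by apply: cvgP; exact: cvg_psum.
Qed.

Lemma psumoo_le K : (forall N, psum c N t <= K) -> psumoo c t <= K.
Proof.
move=> cK; apply: limr_le; first by apply: cvgP; exact: cvg_psum.
exact: nearW.
Qed.

End Bounded.

Lemma eseries_psumoo c t : (forall k, 0 <= c k) -> 0 <= t -> psum_bounded c t ->
  (\sum_(0 <= k <oo) (c k * t ^+ k)%:E = (psumoo c t)%:E)%E.
Proof.
move=> c0 t0 ct; apply: cvg_lim => //.
under eq_fun do rewrite sumEFin big_mkord -/(psum c _ t).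
by apply: cvg_EFin; [exact: nearW | exact: cvg_psum].
Qed.

End PowerSums.

Lemma esumZl (R : realType) (T : choiceType) (X : set T) (a : T -> \bar R) (r : R) :
  0 <= r -> (forall x, 0 <= a x)%E ->
  (\esum_(x in X) (r%:E * a x) = r%:E * \esum_(x in X) a x)%E.
Proof.
move=> r0 a0; rewrite /esum -ereal_supZl //; last first.
  by apply/set0P; exists (\sum_(x \in set0) a x)%E, set0 => //; exact: fsets_set0.
congr ereal_sup; apply/seteqP; split => y.
  move=> [A AX <-]; exists (\sum_(x \in A) a x)%E; first by exists A.
  by rewrite ge0_mule_fsumr.
by move=> [_ [A AX <-] <-]; exists A => //; rewrite ge0_mule_fsumr.
Qed.

Lemma sub_esum (R : realType) (T : choiceType) (X Y : set T) (a : T -> \bar R) :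
  X `<=` Y -> (\esum_(x in X) a x <= \esum_(x in Y) a x)%E.
Proof.
move=> XY; apply: ereal_sup_le => _ [A [Afin AX] <-]; exists A => //.
by split => // x /AX /XY.
Qed.

Section CardFsetSet.
Context {T T' : choiceType}.

Lemma card_fset_set_inj (A : set T) (B : set T') (h : T -> T') :
  finite_set A -> finite_set B -> (forall x, A x -> B (h x)) ->
  (forall x y, A x -> A y -> h x = h y -> x = y) ->
  (#|` fset_set A| <= #|` fset_set B|)%N.
Proof.
move=> Afin Bfin AB hinj.
have <- : #|` [fset h x | x in fset_set A]%fset| = #|` fset_set A|.
  apply: card_in_imfset => x y /=; rewrite !in_fset_set // !inE => Ax Ay.
  exact: hinj.
apply: fsubset_leq_card; apply/fsubsetP => _ /imfsetP[x /= xA ->].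
by move: xA; rewrite !in_fset_set // !inE => /AB.
Qed.

End CardFsetSet.

Lemma card_fset_set_mul (G : groupType) (A B C : set G) :
  finite_set A -> finite_set B -> finite_set C ->
  (forall z, C z -> exists x y, [/\ A x, B y & z = (x * y)%g]) ->
  (#|` fset_set C| <= #|` fset_set A| * #|` fset_set B|)%N.
Proof.
move=> Afin Bfin Cfin CAB.
rewrite -(size_allpairs (fun x y : G => (x * y)%g)); apply: uniq_leq_size; first exact: fset_uniq.
move=> z; rewrite in_fset_set // inE => /CAB[x [y [Ax By ->]]].
by apply/allpairsP; exists (x, y); rewrite /= !in_fset_set // !inE.
Qed.

(** * Spheres, balls and sums over group elements *)

Section Spheres.
Context {n : nat} (g : marked_group n).
Implicit Types (X Y : set g) (T U : {set 'I_n}).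
Local Notation len := (word_length (@mg_spans n g)).
Local Notation ev := (word_eval (@mg_gen n g)).

Definition sphere m : set g := [set x | len x = m].
Definition cnt X m : nat := #|` fset_set (X `&` sphere m)|.

Lemma finite_cnt X m : finite_set (X `&` sphere m).
Proof.
apply: sub_finite_set (finite_word_ball (@mg_spans n g) m) => x [_ xm].
by rewrite /word_ball /= xm.
Qed.

Lemma sub_cnt X Y m : X `<=` Y -> (cnt X m <= cnt Y m)%N.
Proof.
move=> XY; apply: fsubset_leq_card; rewrite -fset_set_sub; [|exact: finite_cnt|exact: finite_cnt].
exact: setSI.
Qed.

(** Sorting the elements by length. Written as a sum over elements, the growth series turns
    factorizations with additive lengths into products. *)
Lemma esum_sphere (R : realType) X (t : R) : 0 <= t ->
  (\esum_(x in X) (t ^+ len x)%:E = \sum_(0 <= k <oo) ((cnt X k)%:R * t ^+ k)%:E)%E.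
Proof.
move=> t0; have XE : X = \bigcup_k (X `&` sphere k).
  by apply/seteqP; split => [x Xx|x [k _ []//]]; exists (len x).
rewrite [in LHS]XE nneseries_sum_bigcup; last 2 first.
- apply/trivIsetP => i j _ _ ij; apply/seteqP; split => // x [[_ xi] [_ xj]].
  by move: ij; rewrite -xi -xj eqxx.
- by move=> x; rewrite lee_fin exprn_ge0.
apply: eq_eseriesr => k _; have fk := finite_cnt X k.
rewrite esum_fset // => [|x _]; last by rewrite lee_fin exprn_ge0.
rewrite fsbig_finite //= (eq_big_seq (fun=> (t ^+ k)%:E)); last first.
  by move=> x; rewrite in_fset_set // inE => -[_ ->].
by rewrite sumEFin big_const_seq count_predT -Monoid.iteropE mulr_natl.
Qed.

Lemma growth_sum m : growth (@mg_spans n g) m = (\sum_(k < m.+1) cnt setT k)%N.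
Proof.
elim: m => [|m IH].
  rewrite big_ord1 /growth /cnt setTI; congr (#|` fset_set _|).
  by apply/seteqP; split => x; rewrite /word_ball /sphere /= leqn0 => /eqP.
rewrite big_ord_recr /= -IH /growth /cnt setTI.
have E : word_ball (@mg_spans n g) m.+1 = word_ball (@mg_spans n g) m `|` sphere m.+1.
  apply/seteqP; split => x; rewrite /word_ball /sphere /=.
    by rewrite leq_eqVlt ltnS => /orP[/eqP|]; [right|left].
  by move=> [/leqW|->].
have f1 := finite_word_ball (@mg_spans n g) m.
have f2 : finite_set (sphere m.+1) by have := finite_cnt setT m.+1; rewrite setTI.
rewrite E fset_setU // cardfsU (_ : (_ `&` _)%fset = fset0) ?cardfs0 ?subn0 //.
apply/fsetP => x; rewrite in_fset0 in_fsetI !in_fset_set //.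
apply/negP => /andP[/set_mem xm /set_mem xm1].
by move: xm; rewrite /word_ball /= xm1 ltnn.
Qed.

Lemma growth_submul m k :
  (growth (@mg_spans n g) (m + k) <= growth (@mg_spans n g) m * growth (@mg_spans n g) k)%N.
Proof.
apply: card_fset_set_mul; try exact: finite_word_ball.
move=> _ /word_ballP[w wl <-]; exists (ev (take m w)), (ev (drop m w)).
split; last by rewrite -ev_cat cat_take_drop.
  by apply/word_ballP; exists (take m w) => //; rewrite size_take_min geq_minl.
by apply/word_ballP; exists (drop m w) => //; rewrite size_drop leq_subLR.
Qed.

End Spheres.

Section Agreement.
Context {n : nat}.
Implicit Types g h : marked_group n.

(** The two words have equal values exactly when [w] times the inverse of [w'] lies in the kernel,
    and this element lies in the ball of radius [r]. *)
Lemma agree_ev g h r (w w' : seq (letter n)) : agree g h r -> (size w + size w' <= r)%N ->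
  word_eval (@mg_gen n g) w = word_eval (@mg_gen n g) w' ->
  word_eval (@mg_gen n h) w = word_eval (@mg_gen n h) w'.
Proof.
move=> gh ww e; pose v := w ++ Defs.finv w'; pose x := word_eval free_gen v.
have px (k : marked_group n) : marked_proj k x = word_eval (@mg_gen n k) v.
  by rewrite /marked_proj val_free_eval word_eval_fmul mulg1.
have : (word_ball (@free_spans n) r `&` marked_ker h) x.
  rewrite -gh; split; last by rewrite /marked_ker /= px ev_cat ev_finv e mulgV.
  rewrite /word_ball /= free_word_length val_free_eval (leq_trans (size_fmul _)) //.
  by rewrite size_cat /Defs.finv size_rev size_map.
move=> [_]; rewrite /marked_ker /= px ev_cat ev_finv => /eqP.
by rewrite divg_eq1 => /eqP.
Qed.

Lemma agree_sym g h r : agree g h r -> agree h g r.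
Proof. exact: esym. Qed.

End Agreement.

Lemma cvg_sumr (R : realType) (I : Type) (r : seq I) (P : pred I) (u : I -> nat -> R) (l : I -> R) :
  (forall i, P i -> u i N @[N --> \oo] --> l i) ->
  \sum_(i <- r | P i) u i N @[N --> \oo] --> \sum_(i <- r | P i) l i.
Proof.
move=> ul; elim: r => [|i r IH].
  by rewrite big_nil; under eq_fun do rewrite big_nil; exact: cvg_cst.
rewrite big_cons; under eq_fun do rewrite big_cons.
by case: ifP => // Pi; apply: cvgD => //; exact: ul.
Qed.

(** For nonempty [V], adding or removing a fixed [v] pairs subsets of opposite sign. *)
Lemma sum_sign_subsets (R : nzRingType) (I : finType) (V : {set I}) :
  \sum_(T : {set I} | T \subset V) (-1) ^+ #|T| = (V == finset.set0)%:R :> R.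
Proof.
have [->|/set0Pn[v vV]] := eqVneq V finset.set0.
  by rewrite (big_pred1 finset.set0) ?cards0 // => T; rewrite finset.subset0.
rewrite (bigID (fun T : {set I} => v \in T)) /=.
rewrite (reindex_onto (fun T => v |: T) (fun T => T :\ v)%SET) /=; last first.
  by move=> T /andP[_ vT]; rewrite finset.setD1K.
rewrite (eq_bigl (fun T : {set I} => (T \subset V) && (v \notin T))) => [|T]; last first.
  rewrite finset.subUset finset.sub1set vV finset.setU11 andbT /=; congr (_ && _).
  by apply/eqP/idP => [<-|vT]; [rewrite finset.setD11 | rewrite finset.setU1K].
rewrite -big_split /= big1 // => T /andP[_ vT].
by rewrite cardsU1 vT add1n exprS mulN1r addNr.
Qed.

(** * Growth series of parabolic subgroups and Solomon's formula *)

Section DyerCounting.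
Context {R : realType} {n : nat} (g : marked_group n).
Context (f : 'I_n -> natbar) (m : 'I_n -> 'I_n -> natbar).
Hypotheses (fm : dyer_data f m) (gP : presented_by g (dyer_relators f m)).
Implicit Types (T U : {set 'I_n}) (k : nat) (t : R).

Local Notation s := (@mg_gen n g).
Local Notation ev := (word_eval s).
Local Notation len := (word_length (@mg_spans n g)).

Definition pcoef T k : R := (cnt (@parabolic n g T) k)%:R.
Definition fcoef T k : R := (cnt (@full n g f T) k)%:R.

Lemma pcoef_ge0 T k : 0 <= pcoef T k. Proof. exact: ler0n. Qed.
Lemma fcoef_ge0 T k : 0 <= fcoef T k. Proof. exact: ler0n. Qed.

(** A tight word over [T] is geodesic, so its two pieces are geodesic words over [T]. *)
Lemma cnt_par_submul T j k :
  (cnt (@parabolic n g T) (j + k) <= cnt (@parabolic n g T) j * cnt (@parabolic n g T) k)%N.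
Proof.
apply: card_fset_set_mul; try exact: finite_cnt.
move=> x [xT xl]; have [w [wT wx tw]] := par_tight fm gP xT.
have wl := tight_len fm gP tw.
have wsz : size w = (j + k)%N by rewrite wl wx.
have l1 : size (take j w) = j by rewrite size_takel // wsz leq_addr.
have l2 : size (drop j w) = k by rewrite size_drop wsz addKn.
have wtd := cat_take_drop j w.
have [oT1 oT2] : over T (take j w) /\ over T (drop j w).
  by move: wT; rewrite -{1}wtd over_cat => /andP[].
exists (ev (take j w)), (ev (drop j w)); split.
- split; first by exists (take j w).
  by rewrite /sphere /= -[RHS]l1; symmetry; apply: (@geodesic_catl _ _ _ (drop j w)); rewrite wtd.
- split; first by exists (drop j w).
  by rewrite /sphere /= -[RHS]l2; symmetry; apply: (@geodesic_catr _ _ (take j w)); rewrite wtd.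
- by rewrite -ev_cat wtd.
Qed.

Lemma par_setT : @parabolic n g finset.setT = setT.
Proof.
apply/seteqP; split => // x _; have [w wx] := mg_spans x; exists w => //.
by apply/allP => a _; rewrite inE.
Qed.

Lemma par_set0 : @parabolic n g finset.set0 = [set 1%g].
Proof.
apply/seteqP; split => [x [[|a w] //= +]|x ->]; last exact: par1.
by rewrite inE.
Qed.

Lemma len1 : len 1%g = 0%N.
Proof. by have := len_ev g [::]; rewrite leqn0 => /eqP. Qed.

Lemma pcoef0 T : pcoef T 0 = 1.
Proof.
rewrite /pcoef /cnt (_ : _ `&` _ = [set 1%g]) ?fset_set1 ?cardfs1 //.
apply/seteqP; split => [x [_ /len_eq0 //]|x ->]; split; first exact: par1.
exact: len1.
Qed.

Lemma pcoef_set0 k : pcoef finset.set0 k.+1 = 0.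
Proof.
rewrite /pcoef /cnt (_ : _ `&` _ = set0) ?fset_set0 ?cardfs0 //.
apply/seteqP; split => // x []; rewrite par_set0 => ->.
by rewrite /sphere /= len1.
Qed.

Lemma pcoefS T U k : T \subset U -> pcoef T k <= pcoef U k.
Proof. by move=> TU; rewrite ler_nat; apply: sub_cnt; exact: parS. Qed.

Lemma sep_len x p : (sep f x p <= len x)%N.
Proof.
have [w <- wx] := ex_geodesic x; rewrite -{1}wx (leq_trans (sep_le fm gP w p)) //.
by rewrite -(size_uncross f w p) leq_addl.
Qed.

Lemma fcoef0 T : T != finset.set0 -> fcoef T 0 = 0.
Proof.
move=> /set0Pn[i iT].
rewrite /fcoef /cnt (_ : _ `&` _ = set0) ?fset_set0 ?cardfs0 //.
apply/seteqP; split => // x [[_ /(_ i iT) xd] x0].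
by move: xd; rewrite /desc -leqn0 (leq_trans (sep_len _ _)) // x0.
Qed.

(** An element of length [k] is sent to the minimal representatives of its crossings of the walls of
    the generators. They lie between [-k] and [k], are shifted by [k] to become ordinals, and
    determine the element by [full_uniq]. *)
Lemma fcoef_le T k : fcoef T k <= ((2 * k).+1 ^ n)%:R.
Proof.
pose rep (x : g) i : int :=
  projT1 (cid2 (cyclic_norm_ex (wall_order f (color f i)) (cross f x (wall_of g f i)))).
have rep1 x i : (wall_order f (color f i) %| (rep x i - cross f x (wall_of g f i))%R)%Z.
  by rewrite /rep; case: cid2.
have rep2 x i : `|rep x i|%N = sep f x (wall_of g f i) by rewrite /rep; case: cid2.
pose h (x : g) : {ffun 'I_n -> 'I_(2 * k).+1} := [ffun i => inord (absz (rep x i + k%:Z)%R)].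
have cardF : (#|` fset_set [set: {ffun 'I_n -> 'I_(2 * k).+1}]| <= (2 * k).+1 ^ n)%N.
  apply: (@leq_trans #|{ffun 'I_n -> 'I_(2 * k).+1}|); last by rewrite card_ffun !card_ord.
  by rewrite cardE; apply: uniq_leq_size; [exact: fset_uniq | move=> u _; rewrite mem_enum].
rewrite ler_nat; apply: leq_trans cardF.
apply: (@card_fset_set_inj _ _ _ _ h) => //; [exact: finite_cnt|exact: finite_finset|].
move=> x y [xf xk] [yf yk] hxy; apply: (full_uniq fm gP xf yf) => i iT bi.
have E : rep x i = rep y i.
  have := congr1 (fun u : {ffun 'I_n -> 'I_(2 * k).+1} => nat_of_ord (u i)) hxy.
  have := sep_len x (wall_of g f i); have := sep_len y (wall_of g f i).
  rewrite -!rep2 xk yk /h !ffunE => lx ly.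
  by rewrite !inordK; lia.
apply: dvdz_trans_sub (rep1 y i); rewrite dvdz_sym -E; exact: rep1.
Qed.

Definition coset_mins U T : set g := @parabolic n g U `&` [set y | coset_min T y].

Lemma coset_mins_sub U T : coset_mins U T `<=` @parabolic n g U.
Proof. by move=> x []. Qed.

(** Inclusion and exclusion for each element [x] separately: [x] is minimal for [T] when [T] lies in
    its set [D x] of non-descents, and the signs cancel unless [D x] is empty. *)
Lemma cnt_coset_mins U k :
  \sum_(T : {set 'I_n} | T \subset U) (-1) ^+ #|T| * (cnt (coset_mins U T) k)%:R = fcoef U k.
Proof.
have fin X := finite_cnt (g := g) X k.
pose D (x : g) := [set i in U | ~~ desc f i x]%SET.
pose F := fset_set (@parabolic n g U `&` sphere k).
have cE (X : set g) : X `<=` @parabolic n g U -> (cnt X k)%:R =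
    \sum_(x <- F) (x \in X)%:R :> R.
  move=> XU; rewrite -natr_sum; congr _%:R.
  transitivity (count (mem X) F); last first.
    rewrite -sum1_count big_mkcond; apply: eq_bigr => x _ /=; by case: (x \in X).
  rewrite -size_filter /cnt; apply: perm_size; apply: uniq_perm.
  - exact: fset_uniq.
  - by rewrite filter_uniq // fset_uniq.
  - move=> x; rewrite mem_filter !in_fset_set // inE; apply/idP/andP.
      by move=> /set_mem[Xx xk]; split; apply/mem_set => //; split => //; exact: XU.
    by move=> [/set_mem Xx /set_mem[_ xk]]; apply/mem_set.
rewrite /fcoef (cE (full f U)) //; last by move=> x [].
under eq_bigr do rewrite (cE _ (@coset_mins_sub U _)) mulr_sumr.
rewrite exchange_big /=; apply: eq_big_seq => x.
rewrite in_fset_set // inE => -[xU _].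
transitivity (\sum_(T : {set 'I_n} | T \subset D x) (-1) ^+ #|T| : R).
  rewrite big_mkcond [RHS]big_mkcond; apply: eq_bigr => T _.
  have [TU|NTU] := boolP (T \subset U); last first.
    case: ifPn => // /fintype.subsetP TD; case/negP: NTU; apply/fintype.subsetP => i /TD.
    by rewrite inE => /andP[].
  have -> : (x \in coset_mins U T) = (T \subset D x).
    apply/idP/fintype.subsetP.
      move=> /set_mem[_ /(coset_minP fm gP) xm] i iT.
      by rewrite inE (fintype.subsetP TU) //= xm.
    move=> TD; apply/mem_set; split => //; apply/(coset_minP fm gP) => i /TD.
    by rewrite inE => /andP[].
  by case: ifP; rewrite ?mulr1 ?mulr0.
rewrite sum_sign_subsets; congr (nat_of_bool _)%:R.
apply/eqP/idP => [D0|/set_mem[_ xf]].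
  apply/mem_set; split => // i iU; apply: contraT => ix.
  have : i \in D x by rewrite inE iU.
  by rewrite D0 inE.
apply/setP => i; rewrite !inE; apply/negP => /andP[/xf ->].
by [].
Qed.

(** Every element of the larger subgroup is uniquely [z * y] with [z] in the smaller one and [y]
    minimal in its coset, and lengths add. *)
Lemma esum_par_factor T U t : T \subset U -> 0 <= t ->
  psum_bounded (pcoef U) t ->
  (\esum_(x in @parabolic n g U) (t ^+ len x)%:E =
   (\esum_(x in @parabolic n g T) (t ^+ len x)%:E) *
   \esum_(x in coset_mins U T) (t ^+ len x)%:E)%E.
Proof.
move=> TU t0 bU.
have tl0 x : (0 <= (t ^+ len x)%:E)%E by rewrite lee_fin exprn_ge0.
set Q := (\esum_(x in coset_mins U T) _)%E.
have Qfin : Q \is a fin_num.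
  rewrite ge0_fin_numE; last exact: esum_ge0.
  apply: le_lt_trans (sub_esum _ (@coset_mins_sub U T)) _.
  rewrite esum_sphere // [X in (X < _)%E](_ : _ = (psumoo (pcoef U) t)%:E) ?ltry //.
  exact: (eseries_psumoo (@pcoef_ge0 U)).
rewrite -(fineK Qfin) muleC -esumZl //; last by rewrite fine_ge0 // esum_ge0.
transitivity (\esum_(z in @parabolic n g T)
    \esum_(y in coset_mins U T) ((t ^+ len z)%:E * (t ^+ len y)%:E))%E; last first.
  by apply: eq_esum => z _; rewrite esumZl ?exprn_ge0 // muleC fineK.
rewrite (esum_esum (J := fun=> coset_mins U T)); last by move=> z y _ _; rewrite mule_ge0.
rewrite (@reindex_esum _ _ _ (@parabolic n g T `*`` (fun=> coset_mins U T)) _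
  (fun p => p.1 * p.2)%g) //; last first.
  split.
  - by move=> [z y] [/= zT [yU _]]; apply: parM => //; exact: parS zT.
  - move=> [z y] [z' y'] /set_mem[/= zT [_ ym]] /set_mem[/= zT' [_ ym']] e.
    by have [-> ->] := coset_min_uniq fm gP ym ym' zT zT' e.
  - move=> x xU; have [z [y [zT ym xE]]] := ex_coset_min T x.
    exists (z, y) => //; split => //; split => //=.
    have -> : y = (z^-1 * x)%g by rewrite xE mulKg.
    by apply: parM => //; apply: parV; exact: parS zT.
apply: eq_esum => -[z y] [/= zT [_ ym]].
by rewrite -EFinM (coset_min_len fm gP ym zT) exprD.
Qed.

Lemma psum_bounded_le (c d : nat -> R) t : 0 <= t -> (forall k, c k <= d k) ->
  psum_bounded d t -> psum_bounded c t.
Proof.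
move=> t0 cd [K dK]; exists K => N; apply: le_trans (dK N).
by apply: ler_sum => k _; rewrite ler_wpM2r // exprn_ge0.
Qed.

Lemma psumoo_par_factor T U t : T \subset U -> 0 <= t -> psum_bounded (pcoef U) t ->
  psumoo (pcoef U) t =
  psumoo (pcoef T) t * psumoo (fun k => (cnt (coset_mins U T) k)%:R) t.
Proof.
move=> TU t0 bU; have := esum_par_factor TU t0 bU; rewrite !esum_sphere //.
have bT : psum_bounded (pcoef T) t.
  by apply: psum_bounded_le bU => // k; exact: pcoefS.
have bQ : psum_bounded (fun k => (cnt (coset_mins U T) k)%:R : R) t.
  by apply: psum_bounded_le bU => // k; rewrite ler_nat; apply: sub_cnt; exact: coset_mins_sub.
rewrite [LHS](_ : _ = (psumoo (pcoef U) t)%:E); last exact: (eseries_psumoo (@pcoef_ge0 U)).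
rewrite [X in (X * _)%E](_ : _ = (psumoo (pcoef T) t)%:E); last exact: (eseries_psumoo (@pcoef_ge0 T)).
by rewrite eseries_psumoo // => -[].
Qed.

Lemma psumoo_par_ge1 T t : 0 <= t -> psum_bounded (pcoef T) t -> 1 <= psumoo (pcoef T) t.
Proof.
move=> t0 bT; apply: le_trans (psum_le_psumoo (@pcoef_ge0 T) t0 bT 1).
by rewrite /psum big_ord1 pcoef0 mul1r expr0.
Qed.

(* Solomon's formula, with the polynomial of the longest element replaced by the
   generating function of the elements having all descents. *)
Lemma solomon U t : 0 <= t -> psum_bounded (pcoef U) t ->
  \sum_(T : {set 'I_n} | T \subset U) (-1) ^+ #|T| / psumoo (pcoef T) t =
  psumoo (fcoef U) t / psumoo (pcoef U) t.
Proof.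
move=> t0 bU.
have A0 T : T \subset U -> psumoo (pcoef T) t != 0.
  move=> TU; rewrite gt_eqF // (lt_le_trans ltr01) // psumoo_par_ge1 //.
  by apply: psum_bounded_le bU => // k; exact: pcoefS.
pose q T k : R := (cnt (coset_mins U T) k)%:R.
have bq T : psum_bounded (q T) t.
  by apply: psum_bounded_le bU => // k; rewrite ler_nat; apply: sub_cnt; exact: coset_mins_sub.
have q0 T k : 0 <= q T k by exact: ler0n.
have bF : psum_bounded (fcoef U) t.
  by apply: psum_bounded_le bU => // k; rewrite ler_nat; apply: sub_cnt => x [].
have E : \sum_(T : {set 'I_n} | T \subset U) (-1) ^+ #|T| * psumoo (q T) t = psumoo (fcoef U) t.
  have := cvg_psum (@fcoef_ge0 U) t0 bF.
  have : \sum_(T : {set 'I_n} | T \subset U) (-1) ^+ #|T| * psum (q T) N t @[N --> \oo] -->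
    \sum_(T : {set 'I_n} | T \subset U) (-1) ^+ #|T| * psumoo (q T) t.
    apply: cvg_sumr => T TU; apply: cvgM; [exact: cvg_cst | exact: cvg_psum].
  rewrite (_ : (fun N => _) = (fun N => psum (fcoef U) N t)); last first.
    apply/funext => N; rewrite /psum; under eq_bigr do rewrite mulr_sumr.
    rewrite exchange_big /=; apply: eq_bigr => k _.
    by rewrite -cnt_coset_mins mulr_suml; apply: eq_bigr => T _; rewrite mulrA.
  by move=> c1 c2; apply: cvg_unique c1 c2.
rewrite -E mulr_suml; apply: eq_bigr => T TU.
rewrite (psumoo_par_factor TU t0 bU) -mulrA; congr (_ * _).
have qn0 : psumoo (q T) t != 0.
  have := A0 U (fintype.subxx _); rewrite (psumoo_par_factor TU t0 bU) mulf_eq0.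
  by rewrite negb_or => /andP[].
by rewrite -/(q T) invfM mulrCA divff // mulr1.
Qed.

End DyerCounting.

(** Spell each element by a geodesic over [T] and evaluate it in [h]. Agreement up to [k + k] makes
    this injective, and a shorter spelling in [h] would also be one in [g], so the length is
    preserved. *)
Lemma cnt_agree_le n (g h : marked_group n) r (T : {set 'I_n}) k :
  is_dyer g -> agree g h r -> (k + k <= r)%N ->
  (cnt (@parabolic n g T) k <= cnt (@parabolic n h T) k)%N.
Proof.
move=> [f [m [fm gP]]] gh kr.
pose P (x : g) w := [/\ over T w, word_eval (@mg_gen n g) w = x & size w = k].
pose rep (x : g) := if pselect (exists w, P x w) is left e then projT1 (cid e) else [::].
have repP x : (@parabolic n g T `&` sphere k) x -> P x (rep x).
  move=> [xT xk]; rewrite /rep; case: pselect => [e|[]]; first by case: cid.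
  have [w [wT wx tw]] := par_tight fm gP xT; exists w; split => //.
  by rewrite (tight_len fm gP tw) wx.
apply: (@card_fset_set_inj _ _ _ _ (fun x => word_eval (@mg_gen n h) (rep x)));
  try exact: finite_cnt.
- move=> x xX; have [wT wx wk] := repP x xX; split; first by exists (rep x).
  have [w' w'l w'x] := ex_geodesic (word_eval (@mg_gen n h) (rep x)).
  rewrite /sphere /=; apply/eqP; rewrite eqn_leq -{1}wk len_ev /= leqNgt; apply/negP => lt.
  have := agree_ev (agree_sym gh) _ w'x; rewrite w'l wk wx => e.
  have xk : word_length (@mg_spans n g) x = k by case: xX.
  have := len_ev g w'; rewrite e ?xk ?w'l; first by rewrite leqNgt lt.
  by apply: leq_trans kr; rewrite leq_add2r ltnW.
- move=> x y /repP[_ xE wx] /repP[_ yE wy] e; rewrite -xE -yE.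
  by apply: (agree_ev (agree_sym gh) _ e); rewrite wx wy.
Qed.

Lemma cnt_agree n (g h : marked_group n) r (T : {set 'I_n}) k :
  is_dyer g -> is_dyer h -> agree g h r -> (k + k <= r)%N ->
  cnt (@parabolic n g T) k = cnt (@parabolic n h T) k.
Proof.
move=> gD hD gh kr; apply/eqP; rewrite eqn_leq (cnt_agree_le _ gD gh) //=.
exact: cnt_agree_le hD (agree_sym gh) kr.
Qed.

(** * Submultiplicative sequences and the identity theorem *)

Section Fekete.
Context {R : realType} (u : nat -> nat).
Hypotheses (u1 : forall m, (1 <= u m)%N) (uM : forall m k, (u (m + k) <= u m * u k)%N).

Let v m : R := (u m)%:R `^ m%:R^-1.

Let vX m : (0 < m)%N -> v m ^+ m = (u m)%:R.
Proof.
move=> m0; rewrite -powR_mulrn ?powR_ge0 // -powRrM mulVf ?powRr1 //.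
by rewrite pnatr_eq0 -lt0n.
Qed.

Let v_ge1 m : 1 <= v m.
Proof.
rewrite -[leLHS](powRr0 (u m)%:R); apply: ler_powR; last by rewrite invr_ge0.
by rewrite ler1n.
Qed.

Lemma submul_block m0 q j : (u (q * m0 + j) <= u m0 ^ q * u j)%N.
Proof.
elim: q => [|q IH]; first by rewrite mul0n add0n expn0 mul1n.
rewrite mulSn -addnA (leq_trans (uM _ _)) // expnS -mulnA leq_mul2l.
by rewrite IH orbT.
Qed.

(** [L] is the infimum of the roots [v m] over [m > 0]. Once [u m0 < x0 ^+ m0], division with
    remainder by [m0] gives [u m <= C * x0 ^+ m] for all [m]; the constant is absorbed by the gap
    between [x0 = L + e / 2] and [x = L + e]. *)
Lemma fekete : exists L : R, [/\ 1 <= L, v m @[m --> \oo] --> L,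
  forall m, L ^+ m <= (u m)%:R
  & forall x, L < x -> exists2 m, (0 < m)%N & (u m)%:R < x ^+ m].
Proof.
pose V := [set v m | m in [set m | (0 < m)%N]].
have V0 : V !=set0 by exists (v 1), 1%N.
have Vlb : lbound V 1 by move=> _ [m _ <-].
have Vinf : has_inf V by split => //; exists 1.
pose L := inf V.
have L1 : 1 <= L by apply: lb_le_inf.
have L0 : 0 < L by apply: lt_le_trans L1.
have Lv m : (0 < m)%N -> L <= v m by move=> m0; apply: ge_inf; [exists 1 | exists m].
have Lu x : L < x -> exists2 m, (0 < m)%N & (u m)%:R < x ^+ m.
  move=> /(inf_lt V0) [_ [m m0 <-] mx]; exists m => //.
  rewrite -vX // ltrXn2r ?lt0n_neq0 ?mx //; last exact: powR_ge0.
exists L; split => //; last first.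
  move=> [|m]; first by rewrite expr0 ler1n.
  by rewrite -vX // lerXn2r ?nnegrE ?powR_ge0 ?Lv // ltW.
apply/cvgrPdist_lt => e e0.
have Le : L < L + e / 2 by rewrite ltrDl divr_gt0.
have [m0 m00 um0] := Lu _ Le; set x0 := L + e / 2 in Le um0.
set x := L + e; have x0x : x0 < x by rewrite /x0 /x ltrD2l ltr_pdivrMr // ltr_pMr // ltr1n.
have x00 : 0 < x0 by apply: lt_trans Le.
have x01 : 1 <= x0 by apply: le_trans (ltW Le).
have xx0 : 0 < x by apply: lt_trans x0x.
pose C : R := (\sum_(j < m0) u j)%:R.
have C0 : 0 < C.
  rewrite ltr0n; case: (m0) m00 => // k _; rewrite big_ord_recl.
  by apply: leq_trans (leq_addr _ _); exact: u1.
have uC m : (u m)%:R <= C * x0 ^+ m.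
  have mE := divn_eq m m0; have jm := ltn_pmod m m00.
  have := submul_block m0 (m %/ m0) (m %% m0); rewrite -mE -(ler_nat R) natrM natrX.
  move=> /le_trans; apply; rewrite mulrC; apply: ler_pM => //.
  - by rewrite ler_nat (bigD1 (Ordinal jm)) //= leq_addr.
  - apply: (@le_trans _ _ ((x0 ^+ m0) ^+ (m %/ m0))).
      by rewrite lerXn2r ?nnegrE ?exprn_ge0 // ltW.
    by rewrite -exprM mulnC ler_weXn2l // leq_trunc_div.
have : (x0 / x) ^+ m @[m --> \oo] --> (0 : R).
  apply: cvg_expr; rewrite ger0_norm ?divr_ge0 ?ltW //.
  by rewrite ltr_pdivrMr // mul1r.
move=> /cvgrPdist_lt/(_ C^-1); rewrite invr_gt0 => /(_ C0) small.
near=> m.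
have m0' : (0 < m)%N by near: m; exact: nbhs_infty_gt.
rewrite distrC ger0_norm ?subr_ge0 ?Lv // ltrBlDl -/x.
suff : v m ^+ m < x ^+ m by rewrite ltr_pXn2r ?nnegrE ?powR_ge0 // ltW.
rewrite vX //; apply: le_lt_trans (uC m) _.
have : `|0 - (x0 / x) ^+ m| < C^-1 by near: m; exact: small.
rewrite sub0r normrN ger0_norm ?exprn_ge0 ?divr_ge0 ?ltW // expr_div_n.
rewrite ltr_pdivrMr ?exprn_gt0 // -ltr_pdivrMl ?invr_gt0 // invrK.
by [].
Unshelve. all: by end_near.
Qed.

End Fekete.

(** * Convergence of submultiplicative power series *)

Section Submultiplicative.
Context {R : realType}.
Implicit Types (c : nat -> R) (t : R).

Definition submul c : Prop :=
  [/\ c 0%N = 1, forall k, 0 <= c k & forall j k, c (j + k)%N <= c j * c k].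

(** Cut the series into blocks of [m0] terms: block [q] is at most [x ^+ q] times the first one, so
    the tail is dominated by a geometric sum. *)
Lemma submul_psum_tail c t m0 L p x : submul c -> 0 <= t ->
  x = c m0 * t ^+ m0 -> x < 1 ->
  psum c ((L + p) * m0) t <=
  psum c (L * m0) t + psum c m0 t * (x ^+ L - x ^+ (L + p)) / (1 - x).
Proof.
move=> [c1 c0 cM] t0 xE x1.
have x0 : 0 <= x by rewrite xE mulr_ge0 // exprn_ge0.
have x1' : 0 < 1 - x by rewrite subr_gt0.
have blk q j : c (q * m0 + j)%N * t ^+ (q * m0 + j) <= x ^+ q * (c j * t ^+ j).
  elim: q => [|q IH]; first by rewrite mul0n add0n expr0 mul1r.
  rewrite mulSn -addnA exprD exprS -(mulrA x).
  apply: le_trans (ler_wpM2l x0 IH).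
  rewrite xE [leRHS]mulrACA; apply: ler_wpM2r (cM _ _).
  by rewrite mulr_ge0 // exprn_ge0.
elim: p => [|p IH]; first by rewrite addn0 subrr mulr0 mul0r addr0.
apply: (@le_trans _ _ (psum c ((L + p) * m0) t + x ^+ (L + p) * psum c m0 t)).
  rewrite addnS mulSn addnC {1}/psum big_split_ord /= lerD2l /psum mulr_sumr.
  by apply: ler_sum => j _; exact: blk.
apply: le_trans (lerD IH (lexx _)) _.
rewrite -addrA lerD2l addnS exprS le_eqVlt; apply/orP; left; apply/eqP.
apply: (mulIf (lt0r_neq0 x1')); rewrite mulrDl !divfK ?lt0r_neq0 //.
set y := x ^+ _; set z := psum _ _ _; set w := x ^+ L; lra.
Qed.

Lemma submul_psum_tail_le c t m0 L N x : submul c -> 0 <= t -> (0 < m0)%N ->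
  x = c m0 * t ^+ m0 -> x < 1 ->
  psum c N t <= psum c (L * m0) t + psum c m0 t * x ^+ L / (1 - x).
Proof.
move=> cS t0 m00 xE x1; have [c1 c0 cM] := cS.
have x0 : 0 <= x by rewrite xE mulr_ge0 // exprn_ge0.
have x1' : 0 < 1 - x by rewrite subr_gt0.
apply: (@le_trans _ _ (psum c ((L + N) * m0) t)).
  apply: psum_nondecreasing => //.
  by rewrite (leq_trans (leq_pmulr N m00)) // leq_mul2r leq_addl orbT.
apply: le_trans (submul_psum_tail L N cS t0 xE x1) _.
rewrite lerD2l -!mulrA ler_wpM2l ?psum_ge0 // ler_pM2r ?invr_gt0 //.
by rewrite gerDl oppr_le0 exprn_ge0.
Qed.

Lemma submul_bounded c t m0 : submul c -> 0 <= t -> (0 < m0)%N ->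
  c m0 * t ^+ m0 < 1 -> psum_bounded c t.
Proof.
move=> cS t0 m00 x1; eexists => N.
exact: (submul_psum_tail_le 0 N cS t0 m00 (erefl _) x1).
Qed.

Lemma bounded_small_term c t : (forall k, 0 <= c k) -> 0 <= t -> psum_bounded c t ->
  exists2 m0, (0 < m0)%N & c m0 * t ^+ m0 < 1.
Proof.
move=> c0 t0 [K cK]; apply: contrapT => H.
have ge1 k : 1 <= c k.+1 * t ^+ k.+1.
  by rewrite leNgt; apply/negP => lt; apply: H; exists k.+1.
have geN N : N%:R <= psum c N.+1 t.
  elim: N => [|N IH]; first exact: psum_ge0.
  by rewrite /psum big_ord_recr /= -natr1 lerD //; exact: ge1.
have := cK (Num.truncn K).+2; rewrite leNgt; apply/negP.
by rewrite negbK; apply: lt_le_trans (geN _); rewrite truncnS_gt.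
Qed.

(** Convergence at [t] is witnessed by one inequality [c m0 * t ^+ m0 < 1]. For [r >= m0 + m0] the
    sequence [d r] satisfies the same inequality, which bounds all the tails uniformly in [r]. *)
Lemma submul_psumoo_cvg c (d : nat -> nat -> R) t : 0 <= t ->
  submul c -> (forall r, submul (d r)) ->
  (forall r k, (k + k <= r)%N -> d r k = c k) -> psum_bounded c t ->
  (\forall r \near \oo, psum_bounded (d r) t) /\
  psumoo (d r) t @[r --> \oo] --> psumoo c t.
Proof.
move=> t0 cS dS dc bc; have [c1 c0 cM] := cS.
have [m0 m00 x1] := bounded_small_term c0 t0 bc.
set x := c m0 * t ^+ m0 in x1; have x0 : 0 <= x by rewrite mulr_ge0 // exprn_ge0.
have x1' : 0 < 1 - x by rewrite subr_gt0.
have dpsum r N : (N + N <= r)%N -> psum (d r) N t = psum c N t.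
  move=> Nr; apply: eq_bigr => k _; rewrite dc //.
  by apply: leq_trans Nr; rewrite leq_add // ltnW.
have dx r : (m0 + m0 <= r)%N -> x = d r m0 * t ^+ m0 by move=> mr; rewrite dc.
have bd r : (m0 + m0 <= r)%N -> psum_bounded (d r) t.
  by move=> mr; apply: (submul_bounded (dS r) t0 m00); rewrite -dx.
split; first by near=> r; apply: bd; near: r; exact: nbhs_infty_ge.
apply/cvgrPdist_le => e e0.
have : psum c m0 t * x ^+ L / (1 - x) @[L --> \oo] --> psum c m0 t * 0 / (1 - x).
  apply: cvgM; last exact: cvg_cst.
  by apply: cvgM; [exact: cvg_cst | apply: cvg_expr; rewrite ger0_norm].
rewrite mulr0 mul0r => /cvgrPdist_le/(_ _ e0)[L _ /(_ L (leqnn L))] /=.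
set w := psum c m0 t * x ^+ L / (1 - x).
have w0 : 0 <= w by rewrite divr_ge0 ?mulr_ge0 ?psum_ge0 ?exprn_ge0 // ltW.
rewrite sub0r normrN ger0_norm // => we.
near=> r.
have r1 : (m0 + m0 <= r)%N by near: r; exact: nbhs_infty_ge.
have r2 : (L * m0 + L * m0 <= r)%N by near: r; exact: nbhs_infty_ge.
have [_ d0 _] := dS r.
have A1 := psum_le_psumoo c0 t0 bc (L * m0).
have A2 := psumoo_le c0 t0 bc (fun N => submul_psum_tail_le L N cS t0 m00 (erefl _) x1).
have B1 := psum_le_psumoo d0 t0 (bd _ r1) (L * m0).
have B2 := psumoo_le d0 t0 (bd _ r1) (fun N => submul_psum_tail_le L N (dS r) t0 m00 (dx _ r1) x1).
rewrite !(dpsum _ _ r1) !(dpsum _ _ r2) -/x -/w in A1 A2 B1 B2.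
by apply: le_trans we; rewrite ler_norml; apply/andP; split; lra.
Unshelve. all: by end_near.
Qed.

End Submultiplicative.

(** * Uniform bounds for coefficients of polynomial growth *)

Section PolynomialCoefficients.
Context {R : realType}.

Lemma geometric_sum_le (q : R) N : 0 <= q < 1 -> \sum_(k < N) q ^+ k <= (1 - q)^-1.
Proof.
move=> /andP[q0 q1]; have q1' : 0 < 1 - q by rewrite subr_gt0.
rewrite -[leRHS]mul1r ler_pdivlMr // mulrC -opprB mulNr -subrX1 opprB.
by rewrite gerDl oppr_le0 exprn_ge0.
Qed.

(** With [p] the square root of [q], one factor [p ^+ m] absorbs one factor [2 * m + 1], since
    [m.+1 * p ^+ m] is at most the geometric sum; the other is left for the induction. *)
Lemma poly_geometric_bounded d (q : R) : 0 <= q < 1 ->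
  exists2 C, 0 <= C & forall m, ((2 * m).+1 ^ d)%:R * q ^+ m <= C.
Proof.
elim: d q => [|d IH] q /andP[q0 q1].
  by exists 1 => // m; rewrite expn0 mul1r exprn_ile1 // ltW.
have p0 : 0 <= Num.sqrt q by exact: sqrtr_ge0.
have p1 : Num.sqrt q < 1 by rewrite -sqrtr1 ltr_sqrt.
have p01 : 0 <= Num.sqrt q < 1 by rewrite p0.
have [C C0 CP] := IH _ p01; set p := Num.sqrt q in p0 p1 p01 CP.
have p1' : 0 < 1 - p by rewrite subr_gt0.
exists (2 * (1 - p)^-1 * C) => [|m]; first by rewrite !mulr_ge0 // invr_ge0 ltW.
have -> : q ^+ m = p ^+ m * p ^+ m by rewrite -exprMn -expr2 sqr_sqrtr.
rewrite expnS natrM mulrACA; apply: ler_pM (CP m).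
- by rewrite mulr_ge0 // exprn_ge0.
- by rewrite mulr_ge0 // exprn_ge0.
apply: (@le_trans _ _ (2 * (m.+1%:R * p ^+ m))).
  rewrite mulrA ler_wpM2r ?exprn_ge0 // -natrM ler_nat; lia.
rewrite ler_wpM2l //; apply: le_trans (geometric_sum_le m.+1 p01).
have -> : m.+1%:R * p ^+ m = \sum_(k < m.+1) p ^+ m.
  by rewrite sumr_const card_ord mulr_natl.
by apply: ler_sum => k _; rewrite ler_wiXn2l // ?ltW // -ltnS.
Qed.

Lemma poly_psum_bounded d (t : R) : 0 <= t < 1 ->
  exists K, forall c : nat -> R, (forall k, c k <= ((2 * k).+1 ^ d)%:R) ->
  forall N, psum c N t <= K.
Proof.
move=> /andP[t0 t1].
have p0 : 0 <= Num.sqrt t by exact: sqrtr_ge0.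
have p01 : 0 <= Num.sqrt t < 1 by rewrite p0 -sqrtr1 ltr_sqrt.
have [C C0 CP] := poly_geometric_bounded d p01; set p := Num.sqrt t in p0 p01 CP.
exists (C * (1 - p)^-1) => c cP N.
apply: (@le_trans _ _ (C * \sum_(k < N) p ^+ k)); last first.
  by rewrite ler_wpM2l // geometric_sum_le.
rewrite mulr_sumr; apply: ler_sum => k _.
have -> : t ^+ k = p ^+ k * p ^+ k by rewrite -exprMn -expr2 sqr_sqrtr.
rewrite mulrA ler_wpM2r ?exprn_ge0 //; apply: le_trans (CP k).
by rewrite ler_wpM2r ?exprn_ge0.
Qed.

End PolynomialCoefficients.

(** * Identity theorem for limits of polynomials *)

Section IdentityTheorem.
Context {R : realType}.
Implicit Types (p q : {poly R}) (r t x M : R).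

(** A submultiplicative norm bounding the values on [[0, r]]. It plays the role of the sup norm on a
    complex disc, so that the argument stays over the reals. *)
Definition pnorm p r : R := \sum_(i < size p) `|p`_i| * r ^+ i.

Lemma pnorm_widen p r N : (size p <= N)%N -> pnorm p r = \sum_(i < N) `|p`_i| * r ^+ i.
Proof.
move=> pN; rewrite /pnorm (big_ord_widen _ (fun i => `|p`_i| * r ^+ i) pN) big_mkcond.
apply: eq_bigr => i _; case: ltnP => // pi.
by rewrite nth_default // normr0 mul0r.
Qed.

Lemma pnorm_ge0 p r : 0 <= r -> 0 <= pnorm p r.
Proof. by move=> r0; apply: sumr_ge0 => i _; rewrite mulr_ge0 // exprn_ge0. Qed.

Lemma horner_pnorm p r t : 0 <= t <= r -> `|p.[t]| <= pnorm p r.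
Proof.
move=> /andP[t0 tr]; rewrite horner_coef (le_trans (ler_norm_sum _ _ _)) //.
apply: ler_sum => i _; rewrite normrM normrX (ger0_norm t0) ler_wpM2l //.
by rewrite lerXn2r ?nnegrE // (le_trans t0).
Qed.

Lemma pnormD p q r : 0 <= r -> pnorm (p + q) r <= pnorm p r + pnorm q r.
Proof.
move=> r0; set N := maxn (size p) (size q).
rewrite (pnorm_widen _ (leq_trans (size_polyD p q) (leqnn N))).
rewrite (pnorm_widen r (leq_maxl _ _ : size p <= N)%N).
rewrite (pnorm_widen r (leq_maxr _ _ : size q <= N)%N) -big_split /=.
apply: ler_sum => i _; rewrite -mulrDl ler_wpM2r ?exprn_ge0 // coefD.
exact: ler_normD.
Qed.

Lemma pnormZ c p r : pnorm (c *: p) r = `|c| * pnorm p r.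
Proof.
rewrite (pnorm_widen r (size_scale_leq c p)) mulr_sumr; apply: eq_bigr => i _.
by rewrite coefZ normrM mulrA.
Qed.

Lemma pnorm_sum (I : Type) (s : seq I) (P : pred I) (F : I -> {poly R}) r : 0 <= r ->
  pnorm (\sum_(i <- s | P i) F i) r <= \sum_(i <- s | P i) pnorm (F i) r.
Proof.
move=> r0; elim: s => [|i s IH]; first by rewrite !big_nil /pnorm size_poly0 big_ord0.
rewrite !big_cons; case: ifP => // _; apply: le_trans (pnormD _ _ r0) _.
by rewrite lerD2l.
Qed.

Lemma pnormXM p r : 0 <= r -> pnorm ('X * p) r <= r * pnorm p r.
Proof.
move=> r0; have sz : (size ('X * p)%R <= (size p).+1)%N.
  by rewrite (leq_trans (size_polyMleq _ _)) // size_polyX.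
rewrite (pnorm_widen r sz) big_ord_recl coefXM eqxx normr0 mul0r add0r mulr_sumr.
apply: ler_sum => i _; rewrite /bump /= coefXM /= add0n exprS.
by rewrite mulrCA.
Qed.

Lemma pnormM p q r : 0 <= r -> pnorm (p * q) r <= pnorm p r * pnorm q r.
Proof.
move=> r0; have XnM i : pnorm ('X^i * q) r <= r ^+ i * pnorm q r.
  elim: i => [|i IH]; first by rewrite expr0 !mul1r.
  rewrite exprS -mulrA (le_trans (pnormXM _ r0)) // exprS -mulrA.
  by rewrite ler_wpM2l.
rewrite -{1}(coefK p) poly_def mulr_suml (le_trans (pnorm_sum _ _ _ r0)) //.
rewrite mulr_suml; apply: ler_sum => i _.
by rewrite -scalerAl pnormZ -mulrA ler_wpM2l.
Qed.

Lemma pnormC c r : pnorm c%:P r <= `|c|.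
Proof.
rewrite (pnorm_widen r (size_polyC_leq1 c)) big_ord1 coefC eqxx expr0 mulr1.
exact: lexx.
Qed.

(* Comparing coefficients in [p - p(x) = (X - x) q] gives [q_j = p_(j+1) + x q_(j+1)]. *)
Lemma pnorm_quotient p q r x : 0 <= x < r -> p - p.[x]%:P = ('X - x%:P) * q ->
  pnorm q r <= pnorm p r / (r - x).
Proof.
move=> /andP[x0 xr] pq; have r0 : 0 <= r by apply: le_trans (ltW xr).
rewrite ler_pdivlMr ?subr_gt0 // mulrC.
set N := maxn (size p) (size q).
have qE j : q`_j = p`_j.+1 + x * q`_j.+1.
  have := congr1 (fun u : {poly R} => u`_j.+1) pq.
  rewrite coefB coefC /= subr0 mulrBl coefB coefXM /= coefCM => ->.
  by rewrite subrK.
have pN : (size p <= N.+1)%N by rewrite leqW // leq_maxl.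
have qN : (size q <= N.+1)%N by rewrite leqW // leq_maxr.
have qN' : (size q <= N)%N by rewrite leq_maxr.
have A : r * pnorm q r <= \sum_(j < N) `|p`_j.+1| * r ^+ j.+1 +
    x * \sum_(j < N) `|q`_j.+1| * r ^+ j.+1.
  rewrite (pnorm_widen r qN') mulr_sumr mulr_sumr -big_split /=.
  apply: ler_sum => j _; rewrite mulrCA -exprS mulrA -mulrDl ler_wpM2r ?exprn_ge0 //.
  by rewrite {1}qE (le_trans (ler_normD _ _)) // normrM (ger0_norm x0).
have B1 : \sum_(j < N) `|p`_j.+1| * r ^+ j.+1 <= pnorm p r.
  by rewrite (pnorm_widen r pN) big_ord_recl /= lerDr mulr_ge0.
have B2 : \sum_(j < N) `|q`_j.+1| * r ^+ j.+1 <= pnorm q r.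
  by rewrite (pnorm_widen r qN) big_ord_recl /= lerDr mulr_ge0.
rewrite mulrBl lerBlDr; apply: le_trans A _; apply: lerD => //.
by rewrite ler_wpM2l.
Qed.

(** A version of the Schwarz lemma. Dividing out a zero [x] of the limit multiplies the norm bound
    by [1 / (r - x)] and the limit at [t] by [1 / (t - x)]; induction on the zeros. *)
Lemma zeros_bound (P : nat -> {poly R}) (xs : seq R) r M t v :
  (forall N, pnorm (P N) r <= M) -> uniq xs -> t \notin xs -> 0 <= t <= r ->
  (forall x, x \in xs -> 0 <= x < r) ->
  (forall x, x \in xs -> (P N).[x] @[N --> \oo] --> (0 : R)) ->
  (P N).[t] @[N --> \oo] --> v ->
  `|v| <= M * \prod_(x <- xs) (`|t - x| / (r - x)).
Proof.
elim: xs P M v => [|x xs IH] P M v PM /=.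
  move=> _ _ tr _ _ Pv; rewrite big_nil mulr1.
  have : `|(P N).[t]| @[N --> \oo] --> `|v| by apply: cvg_norm.
  move=> /cvg_lim <- //; apply: limr_le; first by apply: cvgP; apply: cvg_norm; exact: Pv.
  by apply: nearW => N; apply: le_trans (PM N); exact: horner_pnorm.
move=> /andP[xxs uxs]; rewrite inE negb_or => /andP[tx txs] tr xsr Pxs Pv.
have xr : 0 <= x < r by apply: xsr; rewrite mem_head.
have tx' : t - x != 0 by rewrite subr_eq0.
(* Only the limit vanishes at [x], so the value of [P N] is subtracted before dividing; this does
   not change the limits. *)
pose Q N := (P N - (P N).[x]%:P) %/ ('X - x%:P).
have PQ N : P N - (P N).[x]%:P = ('X - x%:P) * Q N.
  rewrite mulrC divpK //; rewrite dvdp_XsubCl; apply/rootP.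
  by rewrite hornerD hornerN hornerC subrr.
have Qy N y : y != x -> (Q N).[y] = ((P N).[y] - (P N).[x]) / (y - x).
  move=> yx; have := congr1 (fun u : {poly R} => u.[y]) (PQ N).
  rewrite hornerD hornerN hornerC hornerM hornerXsubC => ->.
  by rewrite mulrC mulKf // subr_eq0.
have Px := Pxs x (mem_head _ _).
have := IH Q (M / (r - x)) (v / (t - x)); rewrite big_cons.
have -> : `|v / (t - x)| = `|v| / `|t - x| by rewrite normf_div.
move=> {}IH; have {}IH : `|v| / `|t - x| <= M / (r - x) * \prod_(j <- xs) (`|t - j| / (r - j)).
  apply: IH => //.
  - move=> N; apply: le_trans (pnorm_quotient xr (PQ N)) _.
    by rewrite ler_pM2r ?invr_gt0 ?subr_gt0 //; case/andP: xr.
  - by move=> y yxs; apply: xsr; rewrite inE yxs orbT.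
  - move=> y yxs; have yx : y != x by apply: contraNneq xxs => <-.
    under eq_fun do rewrite Qy //.
    have Py : (P N).[y] @[N --> \oo] --> (0 : R) by apply: Pxs; rewrite inE yxs orbT.
    have : ((P N).[y] - (P N).[x]) / (y - x) @[N --> \oo] --> (0 - 0) / (y - x).
      by apply: cvgM; [exact: cvgB | exact: cvg_cst].
    by rewrite subrr mul0r.
  - under eq_fun do rewrite Qy //.
    have : ((P N).[t] - (P N).[x]) / (t - x) @[N --> \oo] --> (v - 0) / (t - x).
      by apply: cvgM; [exact: cvgB | exact: cvg_cst].
    by rewrite subr0.
move: IH; rewrite ler_pdivrMr ?normr_gt0 // => /le_trans; apply.
by rewrite le_eqVlt; apply/orP; left; apply/eqP; rewrite -!mulrA; congr (_ * _); lra.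
Qed.

Section VanishingLimit.
Context (P : nat -> {poly R}) (r M : R) (h : R -> R).
Hypotheses (PM : forall N, pnorm (P N) r <= M)
  (Ph : forall t, 0 <= t <= r -> (P N).[t] @[N --> \oo] --> h t).

(** [h] has infinitely many zeros [x] just to the right of [c], each contributing a factor
    [|t - x| / (r - x)] of at most 1/2, so [|h t|] is below [M / 2 ^ K] for every [K]. *)
Lemma vanishing_extend c b t : 0 <= t -> t <= c -> c < b -> b < r ->
  c - (r - b) / 4 < t -> (forall x, c < x < b -> h x = 0) -> h t = 0.
Proof.
move=> t0 tc cb br ct hcb.
(* The first bound keeps the zeros [c + y / i.+1] below [b]; the second makes their distance to [t]
   at most [(r - b) / 2], while their distance to [r] exceeds [r - b]. *)
pose y := Num.min ((b - c) / 2) ((r - b) / 4).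
have y0 : 0 < y by rewrite lt_min !divr_gt0 ?subr_gt0.
have y1 : y <= (b - c) / 2 by rewrite ge_min lexx.
have y2 : y <= (r - b) / 4 by rewrite ge_min lexx orbT.
pose pt i : R := c + y / i.+1%:R.
have ptP i : c < pt i <= c + y.
  by rewrite ltrDl divr_gt0 //= lerD2l ler_pdivrMr // ler_pMr // ler1n.
have pt_inj : injective pt.
  move=> i j /addrI /(mulfI (lt0r_neq0 y0)) /invr_inj /eqP.
  by rewrite eqr_nat eqSS => /eqP.
have hK K : `|h t| <= M * (2^-1) ^+ K.
  have rt : 0 <= t <= r by apply/andP; split=> //; lra.
  pose xs := [seq pt i | i <- iota 0 K].
  have xsP x : x \in xs -> exists i, x = pt i by move=> /mapP[i _ ->]; exists i.
  apply: le_trans (zeros_bound (xs := xs) PM _ _ rt _ _ (Ph rt)) _.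
  - by rewrite map_inj_uniq // iota_uniq.
  - apply/negP => /xsP[i tE]; have := ptP i; rewrite -tE => /andP[]; lra.
  - by move=> x /xsP[i ->]; have := ptP i => /andP[? ?]; apply/andP; split; lra.
  - move=> x /xsP[i ->]; have /andP[p1 p2] := ptP i.
    rewrite -(hcb (pt i)); last by apply/andP; split; lra.
    by apply: Ph; apply/andP; split; lra.
  apply: ler_wpM2l; first by apply: le_trans (PM 0); apply: pnorm_ge0; lra.
  have -> : (2^-1 : R) ^+ K = \prod_(x <- xs) 2^-1.
    by rewrite big_const_seq count_predT size_map size_iota -Monoid.iteropE.
  rewrite big_seq [leRHS]big_seq; apply: ler_prod => x /xsP[i ->].
  have /andP[p1 p2] := ptP i; have rp : 0 < r - pt i by lra.
  rewrite divr_ge0 ?normr_ge0 //=; last exact: ltW.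
  rewrite ler_pdivrMr // ler0_norm; last by lra.
  by lra.
have cv : M * (2^-1) ^+ K @[K --> \oo] --> (0 : R).
  rewrite -[X in _ --> X](mulr0 M); apply: cvgM; first exact: cvg_cst.
  by apply: cvg_expr; rewrite ger0_norm ?invr_ge0 // invf_lt1 // ltr1n.
apply/eqP; rewrite -normr_le0 -(cvg_lim _ cv) //; apply: limr_ge; first exact: cvgP cv.
exact: nearW.
Qed.

(** The interval of zeros grows to the left in steps of [(r - b) / 4], a length independent of its
    current left end, so finitely many steps reach 0. *)
Lemma vanishing_identity a b t : 0 <= a -> a < b -> b < r ->
  (forall x, a < x < b -> h x = 0) -> 0 <= t < b -> h t = 0.
Proof.
move=> a0 ab br hab /andP[t0 tb]; pose y := (r - b) / 4.
have y0 : 0 < y by rewrite divr_gt0 ?subr_gt0.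
have hk k : forall x, 0 <= x -> a - k%:R * y < x < b -> h x = 0.
  elim: k => [|k IH] x x0 /andP[ax xb].
    by apply: hab; rewrite xb andbT; move: ax; rewrite mul0r subr0.
  have [lt|ge] := ltP (a - k%:R * y) x; first by apply: IH; rewrite ?lt.
  have ky : 0 <= k%:R * y by rewrite mulr_ge0 // ltW.
  apply: (@vanishing_extend (a - k%:R * y) b) => //; first by lra.
    by move: ax; rewrite -natr1 mulrDl mul1r -/y; lra.
  by move=> z /andP[z1 z2]; apply: IH; [lra | rewrite z1].
apply: (hk (Num.truncn (a / y)).+1) => //; rewrite tb andbT.
apply: lt_le_trans t0; rewrite subr_lt0 -ltr_pdivrMr //; exact: truncnS_gt.
Qed.

End VanishingLimit.

End IdentityTheorem.

(** * Semicontinuity of the growth rate *)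

Lemma expr_unbounded (R : realType) (x K : R) : 1 < x -> exists m, K < x ^+ m.
Proof.
move=> x1; have x0 : 0 < x by apply: lt_trans x1.
have [K0|K0] := leP K 0; first by exists 0%N; rewrite expr0 (le_lt_trans K0).
have : x^-1 ^+ m @[m --> \oo] --> (0 : R).
  by apply: cvg_expr; rewrite ger0_norm ?invr_ge0 ?ltW // invf_lt1.
move=> /cvgrPdist_lt /(_ K^-1); rewrite invr_gt0 => /(_ K0)[m _ /(_ m (leqnn m))] /=.
rewrite sub0r normrN ger0_norm ?exprn_ge0 ?invr_ge0 ?ltW // exprVn.
by rewrite ltf_pV2 ?posrE ?exprn_gt0 // => Km; exists m.
Qed.

(** * Growth rate and radius of convergence *)

Section GrowthRate.
Context {R : realType} {n : nat} (g : marked_group n).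
Local Notation b := (growth (@mg_spans n g)).

Lemma growth_ge1 m : (1 <= b m)%N.
Proof.
rewrite cardfs_gt0; apply/fset0Pn; exists 1%g; rewrite in_fset_set; last exact: finite_word_ball.
by apply/mem_set; rewrite /word_ball /= len1.
Qed.

Lemma growth_rateP : [/\ 1 <= growth_rate R g,
  forall m, growth_rate R g ^+ m <= (b m)%:R
  & forall x, growth_rate R g < x -> exists2 m, (0 < m)%N & (b m)%:R < x ^+ m].
Proof.
have [L [L1 Lc Lu Lx]] := @fekete R _ growth_ge1 (growth_submul g).
by have -> : growth_rate R g = L by exact: cvg_lim.
Qed.

Lemma psum_boundedW (c : nat -> R) t t' : (forall k, 0 <= c k) -> 0 <= t <= t' ->
  psum_bounded c t' -> psum_bounded c t.
Proof.
move=> c0 /andP[t0 tt'] [K cK]; exists K => N; apply: le_trans (cK N).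
by apply: ler_sum => k _; rewrite ler_wpM2l // lerXn2r ?nnegrE // (le_trans t0).
Qed.

Lemma growth_psum m t : 0 <= t <= 1 ->
  (b m)%:R * t ^+ m <= psum (@pcoef R n g finset.setT) m.+1 t.
Proof.
move=> /andP[t0 t1]; rewrite growth_sum natr_sum mulr_suml; apply: ler_sum => k _.
by rewrite /pcoef par_setT ler_wpM2l // ler_wiXn2l // -ltnS.
Qed.

(** The powers of [growth_rate R g * t] are bounded by partial sums of the series. With
    [bounded_growth_rate], this locates the radius of convergence at the inverse of the growth
    rate. *)
Lemma growth_rate_bounded t : 0 <= t <= 1 ->
  psum_bounded (@pcoef R n g finset.setT) t -> growth_rate R g * t <= 1.
Proof.
move=> t01 [K bK]; rewrite leNgt; apply/negP => /(expr_unbounded K)[m].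
apply/negP; rewrite -leNgt exprMn; apply: le_trans (bK m.+1).
apply: le_trans (growth_psum m t01); rewrite ler_wpM2r //.
  by rewrite exprn_ge0 //; case/andP: t01.
by have [_] := growth_rateP.
Qed.

Hypothesis gD : is_dyer g.

Lemma pcoef_submul T : submul (@pcoef R n g T).
Proof.
have [f [m [fm gP]]] := gD; split.
- exact: pcoef0.
- exact: pcoef_ge0.
- by move=> j k; rewrite -natrM ler_nat (cnt_par_submul fm gP).
Qed.

Lemma bounded_growth_rate T t : 0 < t -> growth_rate R g * t < 1 ->
  psum_bounded (@pcoef R n g T) t.
Proof.
move=> t0 gt1; apply: (@psum_bounded_le _ _ (@pcoef R n g finset.setT)); first exact: ltW.
  by move=> k; apply: pcoefS; exact: finset.subsetT.
have [_ _ /(_ t^-1)] := growth_rateP; rewrite -ltr_pdivlMr // div1r in gt1 *.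
move=> /(_ gt1)[m m0 bm]; apply: (submul_bounded (pcoef_submul _) (ltW t0) m0).
rewrite -ltr_pdivlMr ?exprn_gt0 // div1r -exprVn; apply: le_lt_trans bm.
rewrite /pcoef ler_nat par_setT growth_sum (bigD1 (@ord_max m)) //=.
exact: leq_addr.
Qed.

End GrowthRate.

Lemma cvg_prodr (R : realType) (I : Type) (r : seq I) (P : pred I) (u : I -> nat -> R) (l : I -> R) :
  (forall i, P i -> u i N @[N --> \oo] --> l i) ->
  \prod_(i <- r | P i) u i N @[N --> \oo] --> \prod_(i <- r | P i) l i.
Proof.
move=> ul; elim: r => [|i r IH].
  by rewrite big_nil; under eq_fun do rewrite big_nil; exact: cvg_cst.
rewrite big_cons; under eq_fun do rewrite big_cons.
by case: ifP => // Pi; apply: cvgM => //; exact: ul.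
Qed.

(** * Alternating sums of inverses of power series *)

Section AlternatingQuotients.
Context {R : realType} {I : finType} (X : pred I) (e : I -> R).
Implicit Types (a : I -> R) (c : I -> nat -> R).

Lemma sum_inv_prod a : (forall i, X i -> a i != 0) ->
  \sum_(i | X i) e i * \prod_(j | X j && (j != i)) a j =
  (\sum_(i | X i) e i / a i) * \prod_(j | X j) a j.
Proof.
move=> a0; rewrite mulr_suml; apply: eq_bigr => i Xi.
by rewrite [in RHS](bigD1 i) //= -mulrA mulKf // a0.
Qed.

(* Multiplying by the product of the series turns the sum of their inverses into
   a limit of polynomials, to which the identity theorem applies. *)
Lemma sum_inv_vanishing c (r a b t : R) :
  (forall i k, X i -> 0 <= c i k) -> (forall i, X i -> c i 0%N = 1) ->
  (forall i, X i -> psum_bounded (c i) r) ->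
  0 <= a -> a < b -> b < r ->
  (forall x, a < x < b -> \sum_(i | X i) e i / psumoo (c i) x = 0) ->
  0 <= t < b -> \sum_(i | X i) e i / psumoo (c i) t = 0.
Proof.
move=> c0 c1 cr a0 ab br vab /[dup] tb /andP[t0 tb'].
have r0 : 0 <= r by lra.
have cx x : 0 <= x <= r -> forall i, X i -> psum_bounded (c i) x.
  by move=> xr i Xi; apply: psum_boundedW xr (cr i Xi) => k; exact: c0.
have ge1 x : 0 <= x <= r -> forall i, X i -> 1 <= psumoo (c i) x.
  move=> xr i Xi; have /andP[x0 _] := xr.
  apply: le_trans (psum_le_psumoo (c0 i ^~ Xi) x0 (cx _ xr _ Xi) 1).
  by rewrite /psum big_ord1 c1 // mul1r expr0.
have n0 x : 0 <= x <= r -> forall i, X i -> psumoo (c i) x != 0.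
  by move=> xr i Xi; rewrite gt_eqF // (lt_le_trans ltr01) // ge1.
pose h x := \sum_(i | X i) e i * \prod_(j | X j && (j != i)) psumoo (c j) x.
pose p i N : {poly R} := \poly_(k < N) c i k.
pose P N := \sum_(i | X i) e i *: \prod_(j | X j && (j != i)) p j N.
have pE i N x : (p i N).[x] = psum (c i) N x by rewrite horner_poly.
have pn i N : X i -> pnorm (p i N) r <= psumoo (c i) r.
  move=> Xi; rewrite (pnorm_widen r (size_poly _ _)).
  apply: le_trans (psum_le_psumoo (c0 i ^~ Xi) r0 (cr _ Xi) N).
  by apply: ler_sum => k _; rewrite coef_poly ltn_ord ger0_norm // c0.
pose M := \sum_(i | X i) `|e i| * \prod_(j | X j && (j != i)) psumoo (c j) r.
have PM N : pnorm (P N) r <= M.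
  apply: le_trans (pnorm_sum _ _ _ r0) _; apply: ler_sum => i Xi.
  rewrite pnormZ ler_wpM2l //.
  apply: (@le_trans _ _ (\prod_(j | X j && (j != i)) pnorm (p j N) r)); last first.
    by apply: ler_prod => j /andP[Xj _]; rewrite pnorm_ge0 // pn.
  apply: (big_ind2 (fun (u : {poly R}) v => pnorm u r <= v)) => //.
    by apply: le_trans (pnormC 1 r) _; rewrite normr1.
  move=> u v u' v' uv uv'; apply: le_trans (pnormM _ _ r0) _.
  by apply: ler_pM => //; exact: pnorm_ge0.
have Ph x : 0 <= x <= r -> (P N).[x] @[N --> \oo] --> h x.
  move=> xr; have /andP[x0 _] := xr.
  under eq_fun do rewrite horner_sum.
  apply: cvg_sumr => i Xi; under eq_fun do rewrite hornerZ horner_prod.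
  apply: cvgM; first exact: cvg_cst.
  apply: cvg_prodr => j /andP[Xj _]; under eq_fun do rewrite pE.
  by apply: cvg_psum => //; [exact: (c0 j ^~ Xj) | exact: cx].
have hE x : 0 <= x <= r ->
    h x = (\sum_(i | X i) e i / psumoo (c i) x) * \prod_(j | X j) psumoo (c j) x.
  by move=> xr; apply: sum_inv_prod; exact: n0.
have hab x : a < x < b -> h x = 0.
  by move=> xab; rewrite hE ?vab ?mul0r //; case/andP: xab => *; apply/andP; split; lra.
have := vanishing_identity PM Ph a0 ab br hab tb.
have tr : 0 <= t <= r by rewrite t0 /=; lra.
rewrite hE // => /eqP; rewrite mulf_eq0 => /orP[/eqP //|].
by rewrite prodf_seq_eq0 => /hasP[i _ /andP[Xi /eqP]]; have /eqP := n0 t tr i Xi.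
Qed.

End AlternatingQuotients.

(** Without constant term, scaling the argument by [y <= 1] scales the sum by at most [y]; here [y]
    is chosen with [y * K < 1] for a bound [K] at [x]. *)
Lemma psumoo_small (R : realType) (c : nat -> R) (x : R) : (forall k, 0 <= c k) -> c 0%N = 0 ->
  0 < x -> psum_bounded c x -> exists2 t, 0 < t <= x & psumoo c t < 1.
Proof.
move=> c0 c00 x0 bx; have [K bK] := bx.
have K0 : 0 <= K by apply: le_trans (bK 0%N); exact: psum_ge0 (ltW x0).
pose y := (2 * (K + 1))^-1; have y0 : 0 < y by rewrite invr_gt0; lra.
have y1 : y <= 1 by rewrite invf_le1; lra.
have yK : y * K < 1 by rewrite mulrC ltr_pdivrMr; lra.
have yx : y * x <= x by rewrite ger_pMl.
exists (y * x); first by rewrite mulr_gt0.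
have yx0 : 0 <= y * x by rewrite mulr_ge0 // ltW.
have byx : psum_bounded c (y * x) by apply: psum_boundedW bx => //; rewrite yx0.
apply: le_lt_trans yK; apply: psumoo_le => // N.
apply: (@le_trans _ _ (y * psum c N x)); last by rewrite ler_pM2l.
rewrite mulr_sumr; apply: ler_sum => -[[|k] kN] _ /=.
  by rewrite c00 !mul0r mulr0.
rewrite exprMn [leLHS]mulrCA; apply: ler_wpM2r; first by rewrite mulr_ge0 ?exprn_ge0 // ltW.
by rewrite exprS ger_pMr // exprn_ile1 // ltW.
Qed.

Section Solomon.
Context {R : realType} {n : nat} (g : marked_group n).
Context (f : 'I_n -> natbar) (m : 'I_n -> 'I_n -> natbar).
Hypotheses (fm : dyer_data f m) (gP : presented_by g (dyer_relators f m)).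

Lemma solomon_proper (T : {set 'I_n}) (t : R) : 0 <= t -> psum_bounded (@pcoef R n g T) t ->
  \sum_(U : {set 'I_n} | U \proper T) (-1) ^+ #|U| / psumoo (@pcoef R n g U) t =
  (psumoo (@fcoef R n g f T) t - (-1) ^+ #|T|) / psumoo (@pcoef R n g T) t.
Proof.
move=> t0 bT; rewrite mulrBl -(solomon fm gP t0 bT) [in RHS](bigD1 T) //= [RHS]addrAC subrr add0r.
by apply: eq_bigl => U; rewrite finset.properEneq andbC.
Qed.

End Solomon.

(** * Lower semicontinuity *)

Lemma growth_rate_lower (R : realType) n (g : marked_group n) (e : R) :
  is_dyer g -> 0 < e ->
  exists r, forall h, is_dyer h -> agree g h r -> growth_rate R g - e < growth_rate R h.
Proof.
move=> gD e0; apply: contrapT => H.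
have {}H r : exists h, [/\ is_dyer h, agree g h r & growth_rate R h <= growth_rate R g - e].
  apply: contrapT => nH; apply: H; exists r => h hD gh; rewrite ltNge; apply/negP => le.
  by apply: nH; exists h.
have [hs hsP] := choice H.
set a := growth_rate R g in hsP.
have s1 : 1 <= a - e.
  by have [_ _ le] := hsP 0%N; have [h1 _ _] := @growth_rateP R _ (hs 0%N); apply: le_trans le.
have a1 : 1 < a by lra.
(* [x0] is the radius of convergence for [g], and the series of every [hs r] converge below [y0]. *)
pose x0 := a^-1; pose y0 := (a - e)^-1.
have x00 : 0 < x0 by rewrite invr_gt0; lra.
have xy : x0 < y0 by rewrite ltf_pV2 ?posrE; lra.
have y01 : y0 <= 1 by rewrite invf_le1; lra.
(* The bad sets are those whose series does not converge anywhere between [x0] and 1; the full set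
   is one of them. *)
pose A := @pcoef R n g; pose bad (T : {set 'I_n}) :=
  `[< forall t, x0 < t < 1 -> ~ psum_bounded (A T) t >].
have bad_setT : bad finset.setT.
  apply/asboolP => t /andP[xt t1] /growth_rate_bounded.
  have t0 : 0 < t by lra.
  move=> /(_ _); rewrite (ltW t0) (ltW t1) => /(_ isT).
  by apply/negP; rewrite -ltNge -/a -ltr_pdivrMl ?mulr1 //; lra.
case: (@arg_minnP _ finset.setT bad (fun T : {set 'I_n} => #|T|) bad_setT).
move=> T /asboolP badT Tmin.
have T0 : T != finset.set0.
  apply/eqP => T0; apply: (badT ((x0 + 1) / 2)); first by apply/andP; split; lra.
  exists 1 => N; rewrite T0; case: N => [|N]; first by rewrite /psum big_ord0.
  rewrite /psum big_ord_recl big1 ?addr0 /= /A ?pcoef0 ?mul1r ?expr0 // => i _.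
  by rewrite /bump /= add1n pcoef_set0 mul0r.
(* By minimality of [T] the series of a proper subset converges somewhere beyond [x0]. For other
   sets the point is a placeholder. *)
have goodU (U : {set 'I_n}) : exists t,
    [/\ x0 < t, t < 1 & U \proper T -> psum_bounded (A U) t].
  have [UT|_] := boolP (U \proper T); last by exists ((x0 + 1) / 2); split => //; lra.
  have /asboolPn : ~~ bad U.
    by apply/negP => /Tmin; rewrite leqNgt proper_card.
  move=> /existsNP[t /not_implyP[/andP[xt t1] /contrapT bt]].
  by exists t; split.
have [tU tUP] := choice goodU.
(* A common point of convergence for all proper subsets; the default value keeps it below [y0],
   where the series of [hs r] converge too. *)
pose r1 := \big[Num.min/(x0 + y0) / 2]_(U : {set 'I_n} | U \proper T) tU U.
have xr1 : x0 < r1.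
  apply: (big_ind (fun z => x0 < z)); first lra.
    by move=> u v xu xv; rewrite lt_min xu.
  by move=> U _; have [] := tUP U.
have r1y : r1 <= (x0 + y0) / 2 by exact: bigmin_le_id.
have Ar1 (U : {set 'I_n}) : U \proper T -> psum_bounded (A U) r1.
  move=> UT; have [_ _ /(_ UT)] := tUP U; apply: psum_boundedW; first exact: pcoef_ge0.
  by apply/andP; split; [lra | exact: bigmin_le_cond].
pose b := (x0 + r1) / 2.
have Ax x (U : {set 'I_n}) : U \proper T -> 0 <= x <= r1 -> psum_bounded (A U) x.
  by move=> UT xr; apply: psum_boundedW xr (Ar1 U UT); exact: pcoef_ge0.
have unb x K : x0 < x < 1 -> exists N, K < psum (A T) N x.
  move=> xx; apply: contrapT => nN; apply: (badT x xx); exists K => N.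
  by rewrite leNgt; apply/negP => lt; apply: nN; exists N.
have hb r x (U : {set 'I_n}) : 0 < x -> x < y0 -> psum_bounded (@pcoef R n (hs r) U) x.
  move=> x1 x2; have [hD _ le] := hsP r; apply: (bounded_growth_rate hD U x1).
  apply: (@le_lt_trans _ _ ((a - e) * x)); first by rewrite ler_pM2r.
  by rewrite -ltr_pdivlMl ?mulr1 //; lra.
have dA r (U : {set 'I_n}) k : (k + k <= r)%N -> @pcoef R n (hs r) U k = A U k.
  by move=> kr; have [hD gh _] := hsP r; rewrite /A /pcoef (cnt_agree U gD hD gh kr).
(* The sums for [hs r] have two limits: termwise they tend to the sum for [g], and by Solomon's
   formula they tend to 0. *)
have vab x : x0 < x < b ->
    \sum_(U : {set 'I_n} | U \proper T) (-1) ^+ #|U| / psumoo (A U) x = 0.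
  move=> /andP[xx xb]; have x1 : 0 < x by lra.
  have xr : 0 <= x <= r1 by apply/andP; split; rewrite /b in xb; lra.
  have xy0 : x < y0 by rewrite /b in xb; lra.
  have c1 : \sum_(U : {set 'I_n} | U \proper T) (-1) ^+ #|U| / psumoo (@pcoef R n (hs r) U) x
      @[r --> \oo] --> \sum_(U : {set 'I_n} | U \proper T) (-1) ^+ #|U| / psumoo (A U) x.
    apply: cvg_sumr => U UT; apply: cvgM; first exact: cvg_cst.
    apply: cvgV.
      rewrite gt_eqF // (lt_le_trans ltr01) //; apply: psumoo_par_ge1; first exact: ltW.
      exact: Ax.
    apply: (submul_psumoo_cvg (ltW x1) (pcoef_submul gD U) _ _ (Ax _ _ UT xr)).2.
    - by move=> r; have [hD _ _] := hsP r; exact: pcoef_submul.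
    - by move=> r k; exact: dA.
  have [K KP] : exists K, forall c : nat -> R,
      (forall k, c k <= ((2 * k).+1 ^ n)%:R) -> forall N, psum c N x <= K.
    by apply: poly_psum_bounded; apply/andP; split; lra.
  have K0 : 0 <= K.
    by have := KP (fun=> 0) (fun k => ler0n _ _) 0%N; rewrite /psum big_ord0.
  suff c2 : \sum_(U : {set 'I_n} | U \proper T) (-1) ^+ #|U| / psumoo (@pcoef R n (hs r) U) x
      @[r --> \oo] --> (0 : R) by exact: cvg_unique c1 c2.
  apply/cvgrPdist_le => d d0.
  (* In Solomon's formula the numerator is at most [K + 1] in absolute value. The denominator
     exceeds [(K + 1) / d] as soon as [hs r] shares [N] coefficients with [g]. *)
  have [N KN] := unb x ((K + 1) / d) ltac:(apply/andP; split; lra).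
  near=> r.
  have rN : (N + N <= r)%N by near: r; exact: nbhs_infty_ge.
  have [[f [m [fm hP]]] _ _] := hsP r; have bT := hb r x T x1 xy0.
  rewrite sub0r normrN (solomon_proper fm hP (ltW x1) bT) normrM normfV.
  set B := psumoo (pcoef _ T) x; set F := psumoo (fcoef _ _ T) x.
  have bF : psum_bounded (@fcoef R n (hs r) f T) x.
    by exists K => k; apply: KP => j; exact: (fcoef_le fm hP).
  have F0 : 0 <= F.
    by apply: le_trans (psum_le_psumoo (@fcoef_ge0 _ _ _ _ _) (ltW x1) bF 0); rewrite /psum big_ord0.
  have FK : F <= K.
    apply: (psumoo_le (@fcoef_ge0 _ _ _ _ _) (ltW x1) bF) => k.
    by apply: KP => j; exact: (fcoef_le fm hP).
  have BN : (K + 1) / d < B.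
    apply: lt_le_trans KN _; rewrite (_ : psum (A T) N x = psum (@pcoef R n (hs r) T) N x).
      exact: (psum_le_psumoo (@pcoef_ge0 _ _ _ _) (ltW x1) bT).
    apply: eq_bigr => k _; rewrite dA //; apply: leq_trans rN.
    by rewrite leq_add // ltnW.
  have B0 : 0 < B by apply: le_lt_trans BN; rewrite divr_ge0 // ltW //; lra.
  rewrite (ger0_norm (ltW B0)) ler_pdivrMr //.
  apply: (@le_trans _ _ (K + 1)).
    apply: le_trans (ler_normB _ _) _; rewrite normrX normrN1 expr1n.
    by rewrite ger0_norm // lerD2r.
  by rewrite mulrC -ler_pdivrMr // ltW.
have [f [m [fm gP]]] := gD.
(* Below [x0] the series of [T] itself converges, so Solomon's formula holds for [g]. There [t] is
   chosen so small that the series of elements with all descents is less than 1, whereas the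
   vanishing sum forces its absolute value to be 1. *)
have x2 : 0 < x0 / 2 by lra.
have bT2 : psum_bounded (A T) (x0 / 2).
  apply: (bounded_growth_rate gD T x2); rewrite -/a mulrA divff; lra.
have bF2 : psum_bounded (@fcoef R n g f T) (x0 / 2).
  apply: psum_bounded_le bT2 => //; first exact: ltW.
  by move=> k; rewrite ler_nat; apply: sub_cnt => z [].
have [t /andP[t0 tx] Ft] := psumoo_small (@fcoef_ge0 _ _ _ _ _) (fcoef0 fm gP T0) x2 bF2.
have tb : 0 <= t < b by apply/andP; split; rewrite /b; lra.
have bTt : psum_bounded (A T) t.
  by apply: psum_boundedW bT2; [exact: pcoef_ge0 | rewrite (ltW t0)].
have B1 := psumoo_par_ge1 (ltW t0) bTt.
have FE : psumoo (@fcoef R n g f T) t = (-1) ^+ #|T|.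
  have : \sum_(U : {set 'I_n} | U \proper T) (-1) ^+ #|U| / psumoo (A U) t = 0.
    apply: (sum_inv_vanishing _ _ Ar1 (ltW x00) _ _ vab tb).
    - by move=> U k _; exact: pcoef_ge0.
    - by move=> U _; exact: pcoef0.
    - by rewrite /b; lra.
    - by rewrite /b; lra.
  rewrite (solomon_proper fm gP (ltW t0) bTt) => /eqP.
  rewrite mulf_eq0 invr_eq0 => /orP[|/eqP B0]; first by rewrite subr_eq0 => /eqP.
  by move: B1; rewrite B0 ler10.
have : `|psumoo (@fcoef R n g f T) t| = 1 by rewrite FE normrX normrN1 expr1n.
rewrite ger0_norm; first by move=> F1; move: Ft; rewrite F1 ltxx.
have bFt : psum_bounded (@fcoef R n g f T) t.
  by apply: psum_boundedW bF2; [exact: fcoef_ge0 | rewrite (ltW t0)].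
by apply: le_trans (psum_le_psumoo (@fcoef_ge0 _ _ _ _ _) (ltW t0) bFt 0); rewrite /psum big_ord0.
Unshelve. all: by end_near.
Qed.

(** A single [m] with ball size below the [m]-th power of [growth_rate R g + e] suffices: [h] has
    the same ball size once the groups agree up to [m + m]. *)
Lemma growth_rate_upper (R : realType) n (g : marked_group n) (e : R) :
  is_dyer g -> 0 < e ->
  exists r, forall h, is_dyer h -> agree g h r -> growth_rate R h < growth_rate R g + e.
Proof.
move=> gD e0; have [g1 _ gx] := @growth_rateP R _ g.
have [|m m0 bm] := gx (growth_rate R g + e); first by rewrite ltrDl.
exists (m + m)%N => h hD gh; have [h1 hm _] := @growth_rateP R _ h.
rewrite -(@ltr_pXn2r _ m) ?nnegrE //; [|by rewrite (le_trans ler01)|by lra].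
apply: le_lt_trans (hm m) _; apply: le_lt_trans bm; rewrite ler_nat !growth_sum.
apply: leq_sum => k _; rewrite -!par_setT (cnt_agree _ gD hD gh) //.
by rewrite leq_add // -ltnS.
Qed.

(** * Continuity in the metric of marked groups *)

Lemma marked_dist_agree (R : realType) n (g h : marked_group n) r :
  @marked_dist R n g h < expR (- r%:R) -> agree g h r.
Proof.
move=> gh; apply/(@agree_radiusP R); rewrite leNgt; apply/negP => lt.
move: gh; rewrite /marked_dist; have := @agree_radius_ge0 R n g h.
case: (agree_radius g h) lt => [x|//|//]; rewrite lte_fin => xr _ /=.
by rewrite ltr_expR ltrN2 => /lt_trans /(_ xr); rewrite ltxx.
Qed.

Theorem theorem3 (R : realType) (n : nat) (n_ge1 : (1 <= n)%N) :
  set_fun (dyer_space R n) [set r : R | 1 <= r] (@tau R n) /\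
  {within dyer_space R n, continuous (@tau R n)}.
Proof.
split=> [x _|]; first by have [] := @growth_rateP R _ (class_repr x).
have dyer_repr (x : marked_space R n) : dyer_space R n x -> is_dyer (class_repr x).
  by rewrite -{1}(class_reprK x) => /dyer_space_class_of.
apply/subspace_continuousP => x /dyer_repr xD.
apply/cvgrPdist_lt => e e0.
have [r1 lower] := growth_rate_lower xD e0; have [r2 upper] := growth_rate_upper xD e0.
rewrite near_withinE; apply/metricType_numDomainType.nbhs_mdistP.
exists (expR (- (maxn r1 r2)%:R)) => [|y /= xy yD]; first exact: expR_gt0.
have {}yD := dyer_repr y yD.
have xyr : agree (class_repr x) (class_repr y) (maxn r1 r2) by exact: marked_dist_agree xy.
have := lower _ yD (agree_le (leq_maxl r1 r2) xyr).
have := upper _ yD (agree_le (leq_maxr r1 r2) xyr).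
by rewrite /tau ltr_distlC => -> ->.
Qed.
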